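(* Let $W$ be one of the Weyl groups $W_{A_{n-1}}$, $W_{D_n}$ or $W_{B_n}$. The multiplication of the subalgebras induces an isomorphism of vector spaces $$\mathcal C[\xi_1,\dots,\xi_n]\otimes\mathbb C W\otimes\mathcal C[\eta_1,\dots,\eta_n]\longrightarrow\mathbb H_W.$$ Equivalently, the set $\{\xi^{a}\sigma\eta^{b}\}$, where $\sigma\in W$ and $a,b\in\mathbb Z_+^n$, forms a basis of $\mathbb H_W$.
   Context: All algebras are over $\mathbb C$; $[a,b]_+=ab+ba$; $\mathbb Z_+=\{0,1,2,\dots\}$. Weyl groups: $W_{A_{n-1}}=S_n$, $W_{B_n}$ is the group of signed permutations of $1,\dots,n$, $W_{D_n}$ the subgroup of even signed permutations. $s_{ij}$ is the transposition of $i,j$; $\overline s_{ij}$ is the transposition of $i,j$ coupled with sign changes at $i,j$; $\tau_i$ is the sign change at $i$. $W\to S_n$, $\sigma\mapsto\sigma^*$, is the homomorphism forgetting signs ($s_{ij}^*=\overline s_{ij}^*=s_{ij}$, $\tau_i^*=1$); $S_n$ permutes the indices of the $\xi_j$ and of the $\eta_j$. $\mathcal C[b_1,\dots,b_n]$ denotes the skew-polynomial algebra generated by $b_1,\dots,b_n$ with $b_ib_j+b_jb_i=0$ for $i\ne j$ (no condition on $b_i^2$), with basis $b^a=b_1^{a_1}\cdots b_n^{a_n}$, $a\in\mathbb Z_+^n$. Let $t,u,v\in\mathbb C$. The odd double affine Hecke algebra $\mathbb H_W=\mathbb H_W(t,u,v)$ is generated by $\xi_i,\eta_i$ ($1\le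 i\le n$) and $\mathbb C W$ subject to: $\eta_i\eta_j=-\eta_j\eta_i$, $\xi_i\xi_j=-\xi_j\xi_i$ ($i\ne j$); $\sigma\xi_j=\xi_j^{\sigma^*}\sigma$, $\sigma\eta_j=\eta_j^{\sigma^*}\sigma$ ($\sigma\in W$); and, with $i\ne j$: Type $A_{n-1}$: $[\eta_i,\xi_j]_+=us_{ij}$, $\ [\eta_i,\xi_i]_+=t+u\sum_{k\ne i}s_{ki}$. Types $D_n$, $B_n$: $[\eta_i,\xi_j]_+=u(s_{ij}+\overline s_{ij})$, $\ [\eta_i,\xi_i]_+=t+u\sum_{k\ne i}(s_{ki}+\overline s_{ki})+v\tau_i$, where the term $v\tau_i$ is present only in type $B_n$. *)

(* Defs.v *)
From HB Require Import structures.
From mathcomp Require Import all_boot all_order all_algebra all_fingroup.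
From mathcomp Require Import generic_quotient ring_quotient.
From mathcomp Require Import boolp reals complex.
From mathcomp Require Import xfinmap monalg.

Set Implicit Arguments.
Unset Strict Implicit.
Unset Printing Implicit Defensive.

Import GRing.Theory.

Local Open Scope ring_scope.
Local Open Scope quotient_scope.

Section SubspaceQuotient.
Variables (K : fieldType) (V : lmodType K) (S : submodClosed V).

(* A submodClosed predicate is not canonically a zmodClosed one. *)
Definition lquot_pred : {pred V} := S.

Lemma lquot_pred_zmod_closed : zmod_closed lquot_pred.
Proof.
split=> [|x y Sx Sy]; first exact: (rpred0 S).
by rewrite -scaleN1r; apply: (rpredD Sx); apply: rpredZ.
Qed.

HB.instance Definition _ :=
  GRing.isZmodClosed.Build V lquot_pred lquot_pred_zmod_closed.

Definition lquot : Type := Quotient.quot lquot_pred.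

HB.instance Definition _ := GRing.Zmodule.on lquot.

Definition lquot_pi (x : V) : lquot := \pi_(Quotient.quot lquot_pred) x.
Definition lquot_repr (q : lquot) : V := repr (q : Quotient.quot lquot_pred).

Lemma lquot_reprK q : lquot_pi (lquot_repr q) = q.
Proof. exact: reprK. Qed.

Lemma lquot_eqP x y : (lquot_pi x = lquot_pi y) <-> (x - y \in S).
Proof.
rewrite -[x - y \in S]/(x - y \in lquot_pred) Quotient.idealrBE.
by split=> [/eqP|/eqP].
Qed.

Lemma lquot_reprP x : lquot_repr (lquot_pi x) - x \in S.
Proof. by apply/lquot_eqP; rewrite lquot_reprK. Qed.

Lemma lquot_pi_is_zmod_morphism : zmod_morphism lquot_pi.
Proof. by move=> x y; rewrite /lquot_pi !piE. Qed.

HB.instance Definition _ :=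
  GRing.isZmodMorphism.Build V lquot lquot_pi lquot_pi_is_zmod_morphism.

Definition lquot_scale (c : K) (q : lquot) : lquot :=
  lquot_pi (c *: lquot_repr q).

Lemma lquot_scaleE c x : lquot_scale c (lquot_pi x) = lquot_pi (c *: x).
Proof. by apply/lquot_eqP; rewrite -scalerBr rpredZ ?lquot_reprP. Qed.

Lemma lquot_scaleA a b q :
  lquot_scale a (lquot_scale b q) = lquot_scale (a * b) q.
Proof. by rewrite -[q]lquot_reprK !lquot_scaleE scalerA. Qed.

Lemma lquot_scale1 : left_id 1 lquot_scale.
Proof. by move=> q; rewrite -[q]lquot_reprK lquot_scaleE scale1r. Qed.

Lemma lquot_scaleDr : right_distributive lquot_scale +%R.
Proof.
move=> c p q; rewrite -[p]lquot_reprK -[q]lquot_reprK -raddfD !lquot_scaleE.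
by rewrite scalerDr raddfD.
Qed.

Lemma lquot_scaleDl q : {morph lquot_scale^~ q : a b / a + b}.
Proof.
by move=> a b; rewrite -[q]lquot_reprK !lquot_scaleE scalerDl raddfD.
Qed.

HB.instance Definition _ := GRing.Zmodule_isLmodule.Build K lquot
  lquot_scaleA lquot_scale1 lquot_scaleDr lquot_scaleDl.

Lemma lquot_pi_is_scalable : scalable lquot_pi.
Proof. by move=> c x; rewrite -lquot_scaleE. Qed.

HB.instance Definition _ :=
  GRing.isScalable.Build K V lquot *:%R lquot_pi lquot_pi_is_scalable.

End SubspaceQuotient.

Section Span.
Variables (K : fieldType) (V : lmodType K) (G : V -> Prop).

Inductive in_span : V -> Prop :=
| in_span_gen x of G x : in_span x
| in_span0 : in_span 0
| in_spanD x y of in_span x & in_span y : in_span (x + y)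
| in_spanZ c x of in_span x : in_span (c *: x).

Definition span : {pred V} := fun x => `[< in_span x >].

Lemma span_submod_closed : GRing.subsemimod_closed span.
Proof.
split; [split; first exact/asboolP/in_span0 |].
- by move=> x y /asboolP sx /asboolP sy; apply/asboolP/in_spanD.
- by move=> c x /asboolP sx; apply/asboolP/in_spanZ.
Qed.

HB.instance Definition _ :=
  GRing.isSubmodClosed.Build K V span span_submod_closed.

End Span.

Section Tensor.
Variables (K : fieldType) (U V : lmodType K).

Inductive bilin_rel : {malg K[(U * V)%type]} -> Prop :=
| bilin_addl x x' y :
    bilin_rel (<< (x + x', y) >> - (<< (x, y) >> + << (x', y) >>))
| bilin_addr x y y' :
    bilin_rel (<< (x, y + y') >> - (<< (x, y) >> + << (x, y') >>))
| bilin_scalel c x y : bilin_rel (<< (c *: x, y) >> - c *: << (x, y) >>)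
| bilin_scaler c x y : bilin_rel (<< (x, c *: y) >> - c *: << (x, y) >>).

Definition tensor : Type := lquot (span bilin_rel).

HB.instance Definition _ := GRing.Lmodule.on tensor.

Definition tens (x : U) (y : V) : tensor := lquot_pi _ << (x, y) >>.

End Tensor.

Section LinearExtension.
Variables (K : fieldType) (T : choiceType) (V : lmodType K) (f : T -> V).

Definition lin_ext (c : {malg K[T]}) : V := \sum_(k <- msupp c) c@_k *: f k.

Lemma lin_extEw (d : {fset T}) c :
  (msupp c `<=` d)%fset -> lin_ext c = \sum_(k <- d) c@_k *: f k.
Proof.
move=> le; rewrite [LHS](big_fset_incl _ le) //= => k _ /mcoeff_outdom ->.
by rewrite scale0r.
Qed.

Lemma lin_extU c k : lin_ext << c *g k >> = c *: f k.
Proof. by rewrite (lin_extEw msuppU_le) big_seq_fset1 mcoeffUU. Qed.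

Lemma lin_ext_is_linear : linear lin_ext.
Proof.
move=> a c c'; set d := (msupp c `|` msupp c')%fset.
have sc : (msupp c `<=` d)%fset by apply: fsubsetUl.
have sc' : (msupp c' `<=` d)%fset by apply: fsubsetUr.
have sac : (msupp (a *: c + c') `<=` d)%fset.
  apply: fsubset_trans (msuppD_le _ _) _; rewrite fsubUset sc' andbT.
  exact: fsubset_trans (msuppZ_le _ _) sc.
rewrite (lin_extEw sc) (lin_extEw sc') (lin_extEw sac) scaler_sumr -big_split.
apply: eq_bigr => k _ /=.
by rewrite mcoeffD mcoeffZ scalerDl scalerA.
Qed.

HB.instance Definition _ :=
  GRing.isLinear.Build K {malg K[T]} V *:%R lin_ext lin_ext_is_linear.

(* The family f is linearly independent (in particular injective) and spans. *)
Definition is_basis : Prop :=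
  (forall c : {malg K[T]}, lin_ext c = 0 -> c = 0)
  /\ (forall v : V, exists c : {malg K[T]}, v = lin_ext c).

End LinearExtension.

Section AlgebraQuotient.
Variables (K : fieldType) (A : algType K).
Variable rel : A -> A -> Prop.

Inductive in_ideal : A -> Prop :=
| in_ideal_rel p q of rel p q : in_ideal (p - q)
| in_ideal0 : in_ideal 0
| in_idealD x y of in_ideal x & in_ideal y : in_ideal (x + y)
| in_idealMl a x of in_ideal x : in_ideal (a * x)
| in_idealMr a x of in_ideal x : in_ideal (x * a).

Definition ideal : {pred A} := fun x => `[< in_ideal x >].

Lemma ideal_submod_closed : GRing.subsemimod_closed ideal.
Proof.
split; [split; first exact/asboolP/in_ideal0 |].
- by move=> x y /asboolP sx /asboolP sy; apply/asboolP/in_idealD.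
- move=> c x /asboolP sx; apply/asboolP.
  by rewrite -mulr_algl; apply: in_idealMl.
Qed.

HB.instance Definition _ :=
  GRing.isSubmodClosed.Build K A ideal ideal_submod_closed.

Definition alg_quot : Type := lquot ideal.

HB.instance Definition _ := GRing.Lmodule.on alg_quot.

Definition alg_pi : A -> alg_quot := @lquot_pi _ _ _.
HB.instance Definition _ := GRing.Linear.on alg_pi.

Definition alg_repr : alg_quot -> A := @lquot_repr _ _ _.

Lemma alg_reprK x : alg_pi (alg_repr x) = x.
Proof. exact: lquot_reprK. Qed.

Lemma alg_reprP x : in_ideal (alg_repr (alg_pi x) - x).
Proof. by have /asboolP := lquot_reprP ideal x. Qed.

Lemma alg_eqP x y : (alg_pi x = alg_pi y) <-> in_ideal (x - y).
Proof.
split=> [/lquot_eqP/asboolP//|H].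
exact/lquot_eqP/asboolP.
Qed.

Definition alg_quot_mul (x y : alg_quot) : alg_quot :=
  alg_pi (alg_repr x * alg_repr y).

Lemma alg_quot_mulE x y : alg_quot_mul (alg_pi x) (alg_pi y) = alg_pi (x * y).
Proof.
apply/alg_eqP; set x' := alg_repr _; set y' := alg_repr _.
have -> : x' * y' - x * y = (x' - x) * y' + x * (y' - y).
  by rewrite mulrBl mulrBr addrA subrK.
apply: in_idealD; first by apply: in_idealMr; apply: alg_reprP.
by apply: in_idealMl; apply: alg_reprP.
Qed.

Lemma alg_quot_mulA : associative alg_quot_mul.
Proof.
move=> x y z; rewrite -[x]alg_reprK -[y]alg_reprK -[z]alg_reprK.
by rewrite !alg_quot_mulE mulrA.
Qed.

Lemma alg_quot_mul1l : left_id (alg_pi 1) alg_quot_mul.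
Proof. by move=> x; rewrite -[x]alg_reprK alg_quot_mulE mul1r. Qed.

Lemma alg_quot_mul1r : right_id (alg_pi 1) alg_quot_mul.
Proof. by move=> x; rewrite -[x]alg_reprK alg_quot_mulE mulr1. Qed.

Lemma alg_quot_mulDl : left_distributive alg_quot_mul +%R.
Proof.
move=> x y z; rewrite -[x]alg_reprK -[y]alg_reprK -[z]alg_reprK.
by rewrite -raddfD !alg_quot_mulE mulrDl raddfD.
Qed.

Lemma alg_quot_mulDr : right_distributive alg_quot_mul +%R.
Proof.
move=> x y z; rewrite -[x]alg_reprK -[y]alg_reprK -[z]alg_reprK.
by rewrite -raddfD !alg_quot_mulE mulrDr raddfD.
Qed.

(* An algType would require 1 != 0, which fails for some relations; hence only
   a possibly trivial ring, with the algebra axioms alg_quot_scalerAl and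
   alg_quot_scalerAr stated separately. *)
HB.instance Definition _ := GRing.Zmodule_isPzRing.Build alg_quot
  alg_quot_mulA alg_quot_mul1l alg_quot_mul1r alg_quot_mulDl alg_quot_mulDr.

Lemma alg_pi_is_monoid_morphism : monoid_morphism alg_pi.
Proof. by split=> // x y; apply/esym; apply: alg_quot_mulE. Qed.

HB.instance Definition _ :=
  GRing.isMonoidMorphism.Build A alg_quot alg_pi alg_pi_is_monoid_morphism.

Lemma alg_quot_scalerAl c (x y : alg_quot) : c *: (x * y) = (c *: x) * y.
Proof.
rewrite -[x]alg_reprK -[y]alg_reprK -rmorphM -!linearZ /=.
by rewrite -rmorphM scalerAl.
Qed.

Lemma alg_quot_scalerAr c (x y : alg_quot) : c *: (x * y) = x * (c *: y).
Proof.
rewrite -[x]alg_reprK -[y]alg_reprK -rmorphM -!linearZ /=.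
by rewrite -rmorphM scalerAr.
Qed.

Lemma alg_pi_rel p q : rel p q -> alg_pi p = alg_pi q.
Proof. by move=> rpq; apply/alg_eqP/in_ideal_rel. Qed.

Lemma alg_pi_anticomm x y : rel (x * y) (- (y * x)) ->
  alg_pi x * alg_pi y + alg_pi y * alg_pi x = 0.
Proof. by move=> /alg_pi_rel; rewrite raddfN /= !rmorphM /= => ->; rewrite addNr. Qed.

End AlgebraQuotient.

(* The free algebra on I, i.e. the algebra of the free monoid on I.  It is
   wrapped in a record and its operations are locked, since unification would
   otherwise unfold them at length. *)
Record free_alg (K : fieldType) (I : choiceType) :=
  FreeAlg { free_val : {malg K[{fmonom I}]} }.

HB.lock Definition free_add (K : fieldType) (I : choiceType)
  (x y : free_alg K I) : free_alg K I := FreeAlg (free_val x + free_val y).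
HB.lock Definition free_opp (K : fieldType) (I : choiceType)
  (x : free_alg K I) : free_alg K I := FreeAlg (- free_val x).
HB.lock Definition free_mul (K : fieldType) (I : choiceType)
  (x y : free_alg K I) : free_alg K I := FreeAlg (free_val x * free_val y).
HB.lock Definition free_scale (K : fieldType) (I : choiceType)
  (c : K) (x : free_alg K I) : free_alg K I := FreeAlg (c *: free_val x).
HB.lock Definition free_gen (K : fieldType) (I : choiceType)
  (i : I) : free_alg K I := FreeAlg << fmu i >>.

Section FreeAlgebra.
Variables (K : fieldType) (I : choiceType).
Implicit Types (x y : free_alg K I).

HB.instance Definition _ := [isNew for @free_val K I].
HB.instance Definition _ := [Choice of free_alg K I by <:].

Let free_val_inj : injective (@free_val K I). Proof. exact: val_inj. Qed.

Let add := @free_add K I.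
Let opp := @free_opp K I.
Let mul := @free_mul K I.
Let scale := @free_scale K I.
Let addE x y : free_val (add x y) = free_val x + free_val y.
Proof. by rewrite /add free_add.unlock. Qed.
Let oppE x : free_val (opp x) = - free_val x.
Proof. by rewrite /opp free_opp.unlock. Qed.
Let mulE x y : free_val (mul x y) = free_val x * free_val y.
Proof. by rewrite /mul free_mul.unlock. Qed.
Let scaleE c x : free_val (scale c x) = c *: free_val x.
Proof. by rewrite /scale free_scale.unlock. Qed.

Let addA : associative add.
Proof. by move=> x y z; apply: free_val_inj; rewrite !addE addrA. Qed.
Let addC : commutative add.
Proof. by move=> x y; apply: free_val_inj; rewrite !addE addrC. Qed.
Let add0 : left_id (FreeAlg 0) add.
Proof. by move=> x; apply: free_val_inj; rewrite addE add0r. Qed.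
Let addN : left_inverse (FreeAlg 0) opp add.
Proof. by move=> x; apply: free_val_inj; rewrite addE oppE addNr. Qed.

HB.instance Definition _ :=
  GRing.isZmodule.Build (free_alg K I) addA addC add0 addN.

Let mulA : associative mul.
Proof. by move=> x y z; apply: free_val_inj; rewrite !mulE mulrA. Qed.
Let mul1l : left_id (FreeAlg 1) mul.
Proof. by move=> x; apply: free_val_inj; rewrite mulE mul1r. Qed.
Let mul1r : right_id (FreeAlg 1) mul.
Proof. by move=> x; apply: free_val_inj; rewrite mulE mulr1. Qed.
Let mulDl : left_distributive mul add.
Proof. by move=> x y z; apply: free_val_inj; rewrite !(mulE, addE) mulrDl. Qed.
Let mulDr : right_distributive mul add.
Proof. by move=> x y z; apply: free_val_inj; rewrite !(mulE, addE) mulrDr. Qed.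
Let one_neq0 : FreeAlg 1 != FreeAlg 0 :> free_alg K I.
Proof.
by apply/eqP => /(congr1 (@free_val K I)) /= /eqP; rewrite oner_eq0.
Qed.

HB.instance Definition _ := GRing.Zmodule_isNzRing.Build (free_alg K I)
  mulA mul1l mul1r mulDl mulDr one_neq0.

Let scaleA a b x : scale a (scale b x) = scale (a * b) x.
Proof. by apply: free_val_inj; rewrite !scaleE scalerA. Qed.
Let scale1 : left_id 1 scale.
Proof. by move=> x; apply: free_val_inj; rewrite scaleE scale1r. Qed.
Let scaleDr : right_distributive scale add.
Proof.
by move=> c x y; apply: free_val_inj; rewrite !(scaleE, addE) scalerDr.
Qed.
Let scaleDl x : {morph scale^~ x : a b / (a + b)%R >-> add a b}.
Proof.
by move=> a b; apply: free_val_inj; rewrite !(scaleE, addE) scalerDl.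
Qed.

HB.instance Definition _ := GRing.Zmodule_isLmodule.Build K (free_alg K I)
  scaleA scale1 scaleDr scaleDl.

Let mul_malgC (c : K) (x : {malg K[{fmonom I}]}) : x * c%:MP = c *: x.
Proof.
rewrite malgM_def fgmulgU malgZ_def; apply: eq_bigr => m _.
by rewrite mulm1 mulrC.
Qed.

Let scaleAl c x y : scale c (mul x y) = mul (scale c x) y.
Proof. by apply: free_val_inj; rewrite !(scaleE, mulE) fgscaleAl. Qed.

Let scaleAr c x y : scale c (mul x y) = mul x (scale c y).
Proof.
apply: free_val_inj; rewrite !(scaleE, mulE).
by rewrite -mul_malgC -mulrA mul_malgC.
Qed.

HB.instance Definition _ :=
  GRing.Lmodule_isLalgebra.Build K (free_alg K I) scaleAl.
HB.instance Definition _ :=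
  GRing.Lalgebra_isAlgebra.Build K (free_alg K I) scaleAr.

Lemma free_val_is_linear : linear (@free_val K I).
Proof. by move=> c x y; rewrite -scaleE -addE. Qed.

Lemma free_val_is_monoid_morphism : monoid_morphism (@free_val K I).
Proof. by split=> // x y; rewrite -mulE. Qed.

HB.instance Definition _ := GRing.isLinear.Build K (free_alg K I)
  {malg K[{fmonom I}]} *:%R (@free_val K I) free_val_is_linear.
HB.instance Definition _ := GRing.isMonoidMorphism.Build (free_alg K I)
  {malg K[{fmonom I}]} (@free_val K I) free_val_is_monoid_morphism.

Lemma free_val_gen (i : I) :
  free_val (free_gen K i) = << fmu i >> :> {malg K[{fmonom I}]}.
Proof. by rewrite free_gen.unlock. Qed.

End FreeAlgebra.

Section PresentedAlgebra.
Variables (K : fieldType) (I : choiceType).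
Variable rel : free_alg K I -> free_alg K I -> Prop.

Definition pres_alg : Type := alg_quot rel.

HB.instance Definition _ := GRing.Lmodule.on pres_alg.
HB.instance Definition _ := GRing.PzRing.on pres_alg.

Definition pres_gen (i : I) : pres_alg := alg_pi rel (free_gen K i).

End PresentedAlgebra.

(* The algebra morphism out of a presented algebra with prescribed values f on
   the generators; meaningful when f satisfies the relations, see
   pres_homE and pres_hom_is_monoid_morphism. *)
Section PresentedMorphism.
Variables (K : fieldType) (A : algType K) (rA : A -> A -> Prop).
Local Notation B := (alg_quot rA).
Variables (I : choiceType) (f : I -> B).

Definition word_eval (m : {fmonom I}) : B := \prod_(i <- (m : seq I)) f i.

Lemma word_evalM m1 m2 : word_eval (mmul m1 m2) = word_eval m1 * word_eval m2.
Proof. by rewrite /word_eval fmM big_cat. Qed.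

Definition free_eval (p : free_alg K I) : B := lin_ext word_eval (free_val p).

Lemma free_eval_is_linear : linear free_eval.
Proof. by move=> c x y; rewrite /free_eval linearP lin_ext_is_linear. Qed.

HB.instance Definition _ :=
  GRing.isLinear.Build K (free_alg K I) B *:%R free_eval free_eval_is_linear.

Lemma free_eval_gen i : free_eval (free_gen K i) = f i.
Proof.
rewrite /free_eval free_val_gen lin_extU scale1r /word_eval fmU.
by rewrite big_seq1.
Qed.

Lemma free_eval_is_monoid_morphism : monoid_morphism free_eval.
Proof.
split=> [|p q].
  by rewrite /free_eval rmorph1 lin_extU scale1r /word_eval fm1 big_nil.
rewrite /free_eval rmorphM /= malgME raddf_sum /= [X in _ = X * _]/lin_ext.
rewrite mulr_suml; apply: eq_bigr => m1 _.
rewrite raddf_sum /= [X in _ = _ * X]/lin_ext mulr_sumr.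
apply: eq_bigr => m2 _; rewrite lin_extU word_evalM.
by rewrite -alg_quot_scalerAl -alg_quot_scalerAr scalerA.
Qed.

HB.instance Definition _ := GRing.isMonoidMorphism.Build
  (free_alg K I) B free_eval free_eval_is_monoid_morphism.

Lemma free_evalM p q : free_eval (p * q) = free_eval p * free_eval q.
Proof. exact: rmorphM. Qed.

Lemma free_evalD p q : free_eval (p + q) = free_eval p + free_eval q.
Proof. exact: raddfD. Qed.

Variable rel : free_alg K I -> free_alg K I -> Prop.

Definition pres_hom (x : pres_alg rel) : B := free_eval (alg_repr x).

Hypothesis f_rel : forall p q, rel p q -> free_eval p = free_eval q.

Lemma free_eval_ideal p : in_ideal rel p -> free_eval p = 0.
Proof.
elim=> {p} [p q /f_rel e||x y _ ex _ ey|a x _ ex|a x _ ex].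
- by rewrite raddfB /= e subrr.
- by rewrite raddf0.
- by rewrite raddfD /= ex ey addr0.
- by rewrite rmorphM /= ex mulr0.
- by rewrite rmorphM /= ex mul0r.
Qed.

Lemma pres_homE p : pres_hom (alg_pi rel p) = free_eval p.
Proof.
apply/eqP; rewrite -subr_eq0 -raddfB /=; apply/eqP.
exact/free_eval_ideal/alg_reprP.
Qed.

Lemma pres_hom_gen i : pres_hom (pres_gen rel i) = f i.
Proof. by rewrite pres_homE free_eval_gen. Qed.

Lemma pres_hom_is_linear : linear pres_hom.
Proof.
move=> c x y; rewrite -[x]alg_reprK -[y]alg_reprK -linearP /= !pres_homE.
by rewrite linearP.
Qed.

Lemma pres_hom_is_monoid_morphism : monoid_morphism pres_hom.
Proof.
split=> [|x y]; first by rewrite -(rmorph1 (alg_pi rel)) pres_homE rmorph1.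
rewrite -[x]alg_reprK -[y]alg_reprK -(rmorphM (alg_pi rel)) !pres_homE.
by rewrite rmorphM.
Qed.

End PresentedMorphism.

Definition skew_gen (n : nat) : choiceType := 'I_n.

Section SkewPoly.
Variables (K : fieldType) (n : nat).
Local Notation F := (free_alg K (skew_gen n)).
Local Notation b := (@free_gen K (skew_gen n)).

Inductive skew_rel : F -> F -> Prop :=
| skew_anticomm (i j : 'I_n) of i != j : skew_rel (b i * b j + b j * b i) 0.

Definition skew_poly : Type := pres_alg skew_rel.

HB.instance Definition _ := GRing.Lmodule.on skew_poly.
HB.instance Definition _ := GRing.PzRing.on skew_poly.

End SkewPoly.

(* The underlying vector space of the group algebra, with basis gT. *)
Definition group_space (K : fieldType) (gT : finGroupType) : lmodType K :=
  {malg K[gT]}.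

(* x_0^(a 0) * x_1^(a 1) * ... * x_(n-1)^(a (n-1)), in this order. *)
Definition ord_monom (A : pzRingType) (n : nat) (x : 'I_n -> A)
  (a : {ffun 'I_n -> nat}) : A := \prod_(i < n) x i ^+ a i.

(* (i, false) stands for the signed letter +i and (i, true) for -i. *)
Definition letter (n : nat) : finType := ('I_n * bool)%type.

Section SignedPermutations.
Variable n : nat.
Implicit Types s : {perm letter n}.

Definition signed_perms : {set {perm letter n}} :=
  [set s : {perm letter n} |
    [forall x : letter n, s (x.1, ~~ x.2) == ((s x).1, ~~ (s x).2)]].

Lemma signed_permsP s : reflect
  (forall i e, s (i, ~~ e) = ((s (i, e)).1, ~~ (s (i, e)).2))
  (s \in signed_perms).
Proof.
rewrite inE; apply: (iffP forallP) => [H i e|H [i e]]; last exact/eqP/H.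
exact/eqP/(H (i, e)).
Qed.

Lemma signed_perms_group_set : group_set signed_perms.
Proof.
apply/group_setP; split=> [|s r /signed_permsP Hs /signed_permsP Hr].
  by apply/signed_permsP => i e; rewrite !perm1.
apply/signed_permsP => i e; rewrite !permM Hs.
by case: (s (i, e)) => j e'; rewrite Hr.
Qed.

Canonical signed_perms_group := Group signed_perms_group_set.

(* The parity of the number of sign changes of s. *)
Definition sign_parity s : bool := odd #|[set i : 'I_n | (s (i, false)).2]|.

Definition even_signed_perms : {set {perm letter n}} :=
  [set s in signed_perms | ~~ sign_parity s].

Lemma forget_signs_inj s : s \in signed_perms ->
  injective (fun i : 'I_n => (s (i, false)).1).
Proof.
move=> /signed_permsP Hs i j; case Ei: (s (i, false)) => [k e] /=.
case Ej: (s (j, false)) => [l e'] /= kl; case: (eqVneq e e') => [ee'|nee'].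
  by move: Ej; rewrite -kl -ee' -Ei => /perm_inj [].
have: s (i, true) = s (j, false).
  by rewrite (Hs i false) Ei Ej /= kl; case: e e' nee' {Ei Ej} => [] [].
by move/perm_inj.
Qed.

Lemma sign_parityE s : sign_parity s = \big[addb/false]_i (s (i, false)).2.
Proof.
rewrite /sign_parity cardsE -sum1_card big_mkcond /=.
rewrite (big_morph odd oddD (erefl _)); apply: eq_bigr => i _.
by rewrite unfold_in /=; case: (_.2).
Qed.

Lemma sign_parityM s r : s \in signed_perms -> r \in signed_perms ->
  sign_parity (s * r)%g = sign_parity s (+) sign_parity r.
Proof.
move=> Ws /signed_permsP Hr; rewrite !sign_parityE.
rewrite [X in _ = _ (+) X](reindex_inj (forget_signs_inj Ws)) /=.
rewrite -big_split; apply: eq_bigr => i _ /=; rewrite permM.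
case: (s (i, false)) => j [] //=.
by rewrite (Hr j false).
Qed.

Lemma even_signed_perms_group_set : group_set even_signed_perms.
Proof.
apply/group_setP; split=> [|s r].
  rewrite inE group1 sign_parityE big1 // => i _.
  by rewrite perm1.
rewrite ![_ \in even_signed_perms]inE => /andP[Ws ps] /andP[Wr pr].
apply/andP; split; first exact: (groupM (G := signed_perms_group)).
by rewrite sign_parityM // (negbTE ps) (negbTE pr).
Qed.

Canonical even_signed_perms_group := Group even_signed_perms_group_set.

(* These are s_ij, its variant coupled with sign changes at i and j, and tau_i;
   see stranspE, stransp_barE and sflipE. *)
Definition stransp (i j : 'I_n) : {perm letter n} :=
  (tperm (i, false) (j, false) * tperm (i, true) (j, true))%g.
Definition stransp_bar (i j : 'I_n) : {perm letter n} :=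
  (tperm (i, false) (j, true) * tperm (i, true) (j, false))%g.
Definition sflip (i : 'I_n) : {perm letter n} := tperm (i, false) (i, true).

Lemma stranspE i j k e : stransp i j (k, e) = (tperm i j k, e).
Proof.
rewrite /stransp permM !permE /= !xpair_eqE.
case Eki: (k == i); case Ekj: (k == j); case: e;
  by rewrite /= ?xpair_eqE ?andbF /= ?andbT ?Eki ?Ekj //= ?xpair_eqE ?andbF //.
Qed.

Lemma stransp_barE i j k e : i != j ->
  stransp_bar i j (k, e) = (tperm i j k, e (+) ((k == i) || (k == j))).
Proof.
move=> /negbTE ij; rewrite /stransp_bar permM !permE /= !xpair_eqE.
case: (eqVneq k i) => [->|/negbTE ki]; rewrite ?ij;
  [|case: (eqVneq k j) => [->|/negbTE kj]]; case: e;
  by rewrite /= ?xpair_eqE ?[j == i]eq_sym ?ij ?ki ?kj ?eqxx.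
Qed.

Lemma sflipE i k e : sflip i (k, e) = (k, e (+) (k == i)).
Proof.
rewrite /sflip; case: (eqVneq k i) => [->|ki].
  by case: e; rewrite ?tpermL ?tpermR.
by rewrite tpermD ?addbF // xpair_eqE negb_and eq_sym ki.
Qed.

Lemma stransp_even i j : stransp i j \in even_signed_perms.
Proof.
rewrite inE sign_parityE; apply/andP; split.
  by apply/signed_permsP => k e; rewrite !stranspE.
by rewrite big1 // => k _; rewrite stranspE.
Qed.

Lemma stransp_bar_even i j : i != j -> stransp_bar i j \in even_signed_perms.
Proof.
move=> ij; rewrite inE sign_parityE; apply/andP; split.
  by apply/signed_permsP => k e; rewrite !stransp_barE // addNb.
rewrite (bigD1 i) // (bigD1 j) /=; last by rewrite eq_sym.
rewrite !stransp_barE // !eqxx orbT big1 // => k /andP[ki kj].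
by rewrite stransp_barE //= (negbTE ki) (negbTE kj).
Qed.

Lemma sflip_signed i : sflip i \in signed_perms.
Proof. by apply/signed_permsP => k e; rewrite !sflipE addNb. Qed.

Lemma even_signed s : s \in even_signed_perms -> s \in signed_perms.
Proof. by rewrite inE => /andP[]. Qed.

End SignedPermutations.

(* TypeA at n is the type A_(n-1). *)
Inductive weyl_type := TypeA | TypeB | TypeD.

Definition weyl (X : weyl_type) (n : nat) : finGroupType :=
  match X with
  | TypeA => {perm 'I_n}
  | TypeB => subg_of (signed_perms_group n)
  | TypeD => subg_of (even_signed_perms_group n)
  end.

Definition forget_signs (X : weyl_type) (n : nat) : weyl X n -> {perm 'I_n} :=
  match X return weyl X n -> {perm 'I_n} with
  | TypeA => fun s => s
  | TypeB => fun s => perm (forget_signs_inj (subgP s))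
  | TypeD => fun s => perm (forget_signs_inj (even_signed (subgP s)))
  end.

(* inl (inl i), inl (inr i) and inr s name xi_i, eta_i and s in the group. *)
Definition daha_gen (X : weyl_type) (n : nat) : choiceType :=
  ('I_n + 'I_n + weyl X n)%type.

Section FreeElements.
Variables (K : fieldType) (n : nat).

Definition free_xi (X : weyl_type) (i : 'I_n) : free_alg K (daha_gen X n) :=
  free_gen K (inl (inl i) : daha_gen X n).
Definition free_eta (X : weyl_type) (i : 'I_n) : free_alg K (daha_gen X n) :=
  free_gen K (inl (inr i) : daha_gen X n).
Definition free_weyl (X : weyl_type) (s : weyl X n) :
    free_alg K (daha_gen X n) :=
  free_gen K (inr s : daha_gen X n).

Definition anticomm (X : weyl_type) (x y : free_alg K (daha_gen X n)) :=
  x * y + y * x.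

(* Only used for i != j.  In types B and D, subg is applied to elements of the
   group by stransp_even, stransp_bar_even and even_signed. *)
Definition refl_sum (X : weyl_type) (i j : 'I_n) : free_alg K (daha_gen X n) :=
  match X with
  | TypeA => @free_weyl TypeA (tperm i j)
  | TypeB => @free_weyl TypeB (subg _ (stransp i j))
             + @free_weyl TypeB (subg _ (stransp_bar i j))
  | TypeD => @free_weyl TypeD (subg _ (stransp i j))
             + @free_weyl TypeD (subg _ (stransp_bar i j))
  end.

Definition flip_term (X : weyl_type) (v : K) (i : 'I_n) :
    free_alg K (daha_gen X n) :=
  match X with
  | TypeB => v *: @free_weyl TypeB (subg _ (sflip i))
  | _ => 0
  end.

End FreeElements.

Section OddDAHA.
Variables (K : fieldType) (X : weyl_type) (n : nat) (t u v : K).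
Local Notation F := (free_alg K (daha_gen X n)).
Local Notation xi := (@free_xi K n X).
Local Notation eta := (@free_eta K n X).
Local Notation w := (@free_weyl K n X).

(* In daha_mul, the product of s and r in the Weyl group is the composite
   "r, then s", which is (r * s)%g for mathcomp permutations. *)
Inductive daha_rel : F -> F -> Prop :=
| daha_eta i j of i != j : daha_rel (eta i * eta j) (- (eta j * eta i))
| daha_xi i j of i != j : daha_rel (xi i * xi j) (- (xi j * xi i))
| daha_one : daha_rel (w 1%g) 1
| daha_mul s r : daha_rel (w s * w r) (w (r * s)%g)
| daha_weyl_xi s j : daha_rel (w s * xi j) (xi (forget_signs s j) * w s)
| daha_weyl_eta s j : daha_rel (w s * eta j) (eta (forget_signs s j) * w s)
| daha_eta_xi_neq i j of i != j :
    daha_rel (anticomm (eta i) (xi j)) (u *: refl_sum K X i j)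
| daha_eta_xi_eq i :
    daha_rel (anticomm (eta i) (xi i))
      (t%:A + u *: (\sum_(k < n | k != i) refl_sum K X k i) + flip_term X v i).

Definition odd_daha : Type := pres_alg daha_rel.

HB.instance Definition _ := GRing.Lmodule.on odd_daha.
HB.instance Definition _ := GRing.PzRing.on odd_daha.

Definition daha_pi : F -> odd_daha := alg_pi daha_rel.

Definition Xi (i : skew_gen n) : odd_daha := daha_pi (xi i).
Definition Eta (i : skew_gen n) : odd_daha := daha_pi (eta i).
Definition Weyl (s : weyl X n) : odd_daha := daha_pi (w s).

Lemma Xi_skew p q : skew_rel p q -> free_eval Xi p = free_eval Xi q.
Proof.
case=> i j ij; rewrite [RHS]raddf0 free_evalD !free_evalM !free_eval_gen.
exact: alg_pi_anticomm (daha_xi ij).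
Qed.

Lemma Eta_skew p q : skew_rel p q -> free_eval Eta p = free_eval Eta q.
Proof.
case=> i j ij; rewrite [RHS]raddf0 free_evalD !free_evalM !free_eval_gen.
exact: alg_pi_anticomm (daha_eta ij).
Qed.

Definition skew_xi : skew_poly K n -> odd_daha := pres_hom Xi (rel := _).
Definition skew_eta : skew_poly K n -> odd_daha := pres_hom Eta (rel := _).
Definition weyl_map : group_space K (weyl X n) -> odd_daha := lin_ext Weyl.

HB.instance Definition _ := GRing.isLinear.Build K (skew_poly K n) odd_daha
  *:%R skew_xi (pres_hom_is_linear Xi_skew).
HB.instance Definition _ := GRing.isMonoidMorphism.Build (skew_poly K n)
  odd_daha skew_xi (pres_hom_is_monoid_morphism Xi_skew).
HB.instance Definition _ := GRing.isLinear.Build K (skew_poly K n) odd_daha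
  *:%R skew_eta (pres_hom_is_linear Eta_skew).
HB.instance Definition _ := GRing.isMonoidMorphism.Build (skew_poly K n)
  odd_daha skew_eta (pres_hom_is_monoid_morphism Eta_skew).

HB.instance Definition _ := GRing.isLinear.Build K (group_space K (weyl X n))
  odd_daha *:%R weyl_map (lin_ext_is_linear Weyl).

Lemma skew_xi_gen i : skew_xi (pres_gen _ i) = Xi i.
Proof. exact: pres_hom_gen Xi_skew i. Qed.

Lemma skew_eta_gen i : skew_eta (pres_gen _ i) = Eta i.
Proof. exact: pres_hom_gen Eta_skew i. Qed.

End OddDAHA.

(* Main.v *)
Require Import Defs.
From HB Require Import structures.
From mathcomp Require Import all_boot all_order all_algebra all_fingroup.
From mathcomp Require Import boolp reals complex.
From mathcomp Require Import xfinmap monalg.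

Set Implicit Arguments.
Unset Strict Implicit.
Unset Printing Implicit Defensive.

Import GRing.Theory.

Local Open Scope ring_scope.

(** The monomials [xi^a w eta^b] span because the relations move any generator
    standing to the left of such a monomial to its place.  Writing [S] for
    their span, it is enough that [S] is stable under left multiplication by
    the generators: by [xi j] up to a sign ([spanned_Xi]), then by the group,
    which commutes with the [xi] up to permuting them ([spanned_Weyl]), then by
    [eta i] through the rule [eta i * xi j = A i j - xi j * eta i], where
    [A i j] lies in the group algebra ([spanned_Eta]).

    They are independent because the algebra acts on the space with basis
    [(a, w, b)] as if they were.  As a module over the skew polynomials in the
    [xi] this space is induced from its vectors [(0, w, b)], so a linear map
    out of it which intertwines the [xi] with given anticommuting operators
    exists and is unique once its values on the [(0, w, b)] are chosen
    ([pbw_rec], [pbw_ind]).  The group acts by such maps.  The operator [eta i]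
    does not intertwine anything by itself, but the pair [(eta i x, x)] does:
    when [x] is replaced by [xi j x], the pair [(p, q)] becomes
    [(A i j q - xi j p, xi j q)].  These operators on pairs anticommute exactly
    when [[A i j, xi k] + [A i k, xi j] = 0] for [j != k]; this identity
    ([bracket_jacobi]) is the heart of the proof, and it follows from
    the fact that a reflection in [A i j] with [i != j] permutes the indices by
    the transposition of [i] and [j].  The same identity, with the [eta] in
    place of the [xi], gives the anticommutation of the [eta] operators.  All
    relations being satisfied, the orbit map of the vector [(0, 1, 0)] sends
    [xi^a w eta^b] to the basis vector [(a, w, b)] ([pbw_coordinates],
    [pbw_monom_free]).

    For the tensor product, the monomials of the factors span it, and the
    multiplication map carries them to the basis just found; hence it is
    bijective. *)

(** * Weyl groups *)

Section WeylGroup.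
Variables (X : weyl_type) (n : nat).
Local Notation W := (weyl X n).
Implicit Types (s r : W) (i j : 'I_n).

Lemma forget_signsM s r :
  forget_signs (s * r)%g = (forget_signs s * forget_signs r)%g.
Proof.
case: X s r => s r //; apply/permP => i; rewrite permM /= !permE /=.
- case: (sgval s _) => j [] //=.
  by have /signed_permsP/(_ j false) -> := subgP r.
- case: (sgval s _) => j [] //=.
  by have /even_signed/signed_permsP/(_ j false) -> := subgP r.
Qed.

Lemma forget_signs1 i : forget_signs (1%g : W) i = i.
Proof.
have E : forget_signs (1%g : W) = 1%g.
  by apply: (mulgI (forget_signs (1%g : W))); rewrite -forget_signsM !mulg1.
by rewrite E perm1.
Qed.

Definition reflections (i j : 'I_n) : seq W :=
  match X return seq (weyl X n) with
  | TypeA => [:: tperm i j]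
  | TypeB => [:: subg (signed_perms_group n) (stransp i j);
                 subg (signed_perms_group n) (stransp_bar i j)]
  | TypeD => [:: subg (even_signed_perms_group n) (stransp i j);
                 subg (even_signed_perms_group n) (stransp_bar i j)]
  end.

Definition sign_flips (i : 'I_n) : seq W :=
  match X return seq (weyl X n) with
  | TypeB => [:: subg (signed_perms_group n) (sflip i)]
  | _ => [::]
  end.

End WeylGroup.

Section Conjugation.

Lemma subgJ (gT : finGroupType) (G : {group gT}) (x : gT) (s : subg_of G) :
  x \in G -> subg G (x ^ sgval s)%g = (subg G x ^ s)%g.
Proof.
by move=> Gx; apply: val_inj; rewrite /= subgK ?groupJ ?subgP //= subgK.
Qed.

Variable n : nat.
Implicit Types (i j : 'I_n) (s : {perm letter n}).

Lemma stranspC i j : stransp i j = stransp j i.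
Proof. by rewrite /stransp; congr (_ * _)%g; apply: tpermC. Qed.

Lemma stransp_barC i j : i != j -> stransp_bar i j = stransp_bar j i.
Proof.
move=> ij; apply/permP => -[k e].
by rewrite (stransp_barE k e ij) stransp_barE 1?eq_sym // tpermC orbC.
Qed.

(** A signed permutation carries the sign-preserving transposition of two
    letters to the sign-preserving or to the sign-changing one, according to
    whether it gives these letters equal or opposite signs. *)
Lemma stransp_conj s i j : s \in signed_perms n -> i != j ->
  perm_eq [:: stransp i j ^ s; stransp_bar i j ^ s]%g
          [:: stransp (s (i, false)).1 (s (j, false)).1;
              stransp_bar (s (i, false)).1 (s (j, false)).1].
Proof.
move=> Ws ij; have kl := contra_neq (@forget_signs_inj _ _ Ws i j) ij.
move/signed_permsP: Ws => Hs; have Ei := Hs i false; have Ej := Hs j false.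
(* When a letter changes sign, the two factors appear in the other order. *)
have C (k l : 'I_n) : k != l ->
    (tperm (k, true) (l, true) * tperm (k, false) (l, false) = stransp k l)%g.
  move=> kl'; apply/permP => -[m e]; rewrite stranspE permM !permE /=.
  rewrite !xpair_eqE.
  case: (eqVneq m k) => [->|/negbTE mk]; rewrite ?(negbTE kl');
    [|case: (eqVneq m l) => [->|/negbTE ml]]; case: e => /=;
    by rewrite ?xpair_eqE /= ?eqxx ?mk ?ml ?andbF ?andbT //= ?[l == k]eq_sym
         ?(negbTE kl').
have C' (k l : 'I_n) : k != l ->
    (tperm (k, true) (l, false) * tperm (k, false) (l, true)
     = stransp_bar k l)%g.
  move=> kl'; rewrite (stransp_barC kl') /stransp_bar.
  by rewrite [X in (X * _)%g]tpermC [X in (_ * X)%g]tpermC.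
rewrite /stransp /stransp_bar !conjMg !tpermJ /= Ei Ej.
case: (s (i, false)) (s (j, false)) kl {Ei Ej} => k [] [l []] /= kl;
  by rewrite ?C ?C' // (perm_catC [:: _] [:: _]).
Qed.

Lemma sflip_conj s i : s \in signed_perms n ->
  (sflip i ^ s)%g = sflip (s (i, false)).1.
Proof.
move=> /signed_permsP Hs; rewrite /sflip tpermJ (Hs i false).
by case: (s (i, false)) => k [] //=; rewrite tpermC.
Qed.

End Conjugation.

Section ReflectionTheory.
Variables (X : weyl_type) (n : nat).
Local Notation W := (weyl X n).
Local Notation refl := (reflections X).
Local Notation flips := (sign_flips X).
Implicit Types (s r : W) (i j k : 'I_n).

Lemma reflectionsC i j : i != j -> refl i j = refl j i.
Proof.
by move=> ij; rewrite /reflections tpermC stranspC (stransp_barC ij).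
Qed.

Lemma forget_signs_reflection i j r :
  i != j -> r \in refl i j -> forget_signs r = tperm i j.
Proof.
move=> ij; rewrite /reflections; case: X r => r; rewrite !inE.
- by move/eqP.
- have Hs := even_signed (stransp_even i j).
  have Hb := even_signed (stransp_bar_even ij).
  by case/orP=> /eqP ->; apply/permP => k;
    rewrite permE /= subgK // ?stranspE ?stransp_barE.
- have Hs := stransp_even i j; have Hb := stransp_bar_even ij.
  by case/orP=> /eqP ->; apply/permP => k;
    rewrite permE /= subgK // ?stranspE ?stransp_barE.
Qed.

Lemma forget_signs_flip i r j : r \in flips i -> forget_signs r j = j.
Proof.
rewrite /sign_flips; case: X r => r //; rewrite !inE => /eqP ->.
by rewrite permE /= subgK ?sflip_signed // sflipE.
Qed.

Lemma reflections_conj s i j : i != j ->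
  perm_eq [seq (r ^ s)%g | r <- refl i j]
          (refl (forget_signs s i) (forget_signs s j)).
Proof.
move=> ij; rewrite /reflections; case: X s => s /=.
- by rewrite tpermJ.
- have Hs := even_signed (stransp_even i j).
  have Hb := even_signed (stransp_bar_even ij).
  rewrite -!subgJ // !permE; have := stransp_conj (subgP s) ij.
  exact: (perm_map (subg (signed_perms_group n))).
- have Hs := stransp_even i j; have Hb := stransp_bar_even ij.
  rewrite -!subgJ // !permE; have := stransp_conj (even_signed (subgP s)) ij.
  exact: (perm_map (subg (even_signed_perms_group n))).
Qed.

Lemma sign_flips_conj s i :
  [seq (r ^ s)%g | r <- flips i] = flips (forget_signs s i).
Proof.
rewrite /sign_flips; case: X s => s //=; congr [:: _].
by rewrite permE /= -(sflip_conj _ (subgP s)) -subgJ ?sflip_signed.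
Qed.

End ReflectionTheory.
(** * Monomials in anticommuting operators *)

Section Exponents.
Variables (K : fieldType) (n : nat).
Local Notation expo := {ffun 'I_n -> nat}.
Implicit Types (a : expo) (i j : 'I_n).

Definition expo0 : expo := [ffun=> 0%N].

Definition expo_incr j a : expo := [ffun k => (a k + (k == j))%N].

(** Moving one more factor of index [j] from the left end of a monomial of
    exponent [a] to its place crosses the factors of smaller index. *)
Definition expo_sign j a : K := (-1) ^+ (\sum_(k < n | (k < j)%N) a k)%N.

Lemma expo_signK j a : expo_sign j a * expo_sign j a = 1.
Proof. by rewrite -expr2 sqrr_sign. Qed.

Lemma expo_incrC i j a :
  expo_incr i (expo_incr j a) = expo_incr j (expo_incr i a).
Proof. by apply/ffunP => k; rewrite !ffunE addnAC. Qed.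

Lemma expo_sign_incr i j a :
  expo_sign i (expo_incr j a) = (-1) ^+ (j < i)%N * expo_sign i a.
Proof.
rewrite /expo_sign -exprD addnC.
under eq_bigr do rewrite ffunE; rewrite big_split /=; congr (_ ^+ (_ + _)).
have [ji|ij] := boolP (j < i)%N.
  by rewrite (bigD1 j) //= eqxx big1 // => k /andP[_ /negbTE ->].
by rewrite big1 // => k ki; case: eqVneq ij => // <-; rewrite ki.
Qed.

(** The larger of the two indices crosses one more factor when it is moved
    second, the smaller one does not. *)
Lemma expo_sign_anticomm i j a : i != j ->
  expo_sign i (expo_incr j a) * expo_sign j a
  = - (expo_sign j (expo_incr i a) * expo_sign i a).
Proof.
move=> ij; rewrite !expo_sign_incr -!mulrA.
rewrite [X in _ = - (_ * X)]mulrC; move: ij; rewrite -val_eqE /= neq_ltn.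
by case/orP=> lij; rewrite lij ltnNge (ltnW lij) /=
  !(expr0, expr1, mul1r, mulN1r) ?opprK.
Qed.

Lemma expo_ind (P : expo -> Prop) :
  P expo0 -> (forall j a, P a -> P (expo_incr j a)) -> forall a, P a.
Proof.
move=> P0 PS a; have [m le_m] := ubnP (\sum_i a i)%N.
elim: m => // m IH in a le_m *; have [j aj|a0] := pickP (fun j => a j != 0%N).
  pose b : expo := [ffun k => (a k - (k == j))%N].
  have le_ja k : ((k == j) <= a k)%N by case: eqVneq => // ->; rewrite lt0n.
  have -> : a = expo_incr j b by apply/ffunP => k; rewrite !ffunE subnK.
  apply: PS; apply: IH; rewrite -ltnS; apply: leq_trans le_m.
  rewrite ltnS [X in (_ < X)%N](bigD1 j) // [X in (X < _)%N](bigD1 j) //=.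
  rewrite -addSn leq_add //; first by rewrite ffunE eqxx subn1 prednK // lt0n.
  by apply: leq_sum => k _; rewrite ffunE leq_subr.
suff -> : a = expo0 by [].
by apply/ffunP => k; rewrite ffunE; apply/eqP/negbFE/a0.
Qed.

End Exponents.

Section MonomialAction.
Variable n : nat.
Local Notation expo := {ffun 'I_n -> nat}.

Definition monom_act (U : Type) (x : 'I_n -> U -> U) (a : expo) (u : U) : U :=
  foldr (fun i => iter (a i) (x i)) u (index_enum 'I_n).

Lemma monom_act0 (U : Type) (x : 'I_n -> U -> U) u :
  monom_act x (expo0 n) u = u.
Proof.
by rewrite /monom_act; elim: index_enum => //= i r ->; rewrite ffunE.
Qed.

Lemma monom_act_closed (U : Type) (P : U -> Prop) (x : 'I_n -> U -> U) a u :
  (forall i w, P w -> P (x i w)) -> P u -> P (monom_act x a u).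
Proof.
move=> Px Pu; rewrite /monom_act; elim: index_enum => //= i r IH.
by elim: (a i) => //= m; apply: Px.
Qed.

Lemma ord_monom_act (A : pzRingType) (x : 'I_n -> A) (a : expo) (h : A) :
  ord_monom x a * h = monom_act (fun i => *%R (x i)) a h.
Proof.
rewrite /ord_monom /monom_act; elim: index_enum => [|i r IH] /=.
  by rewrite big_nil mul1r.
rewrite big_cons -mulrA IH; elim: (a i) => [|m]; first by rewrite mul1r.
by rewrite exprS -mulrA => ->.
Qed.

Section Anticommuting.
Variables (K : fieldType) (U : lmodType K) (x : 'I_n -> U -> U).
Implicit Types (a : expo) (u : U).

Hypothesis x_scal : forall i c u, x i (c *: u) = c *: x i u.
Hypothesis x_anti : forall i j u, i != j -> x i (x j u) = - x j (x i u).

Lemma iter_anticomm i j m u : i != j ->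
  x i (iter m (x j) u) = (-1) ^+ m *: iter m (x j) (x i u).
Proof.
move=> ij; elim: m => [|m IH]; first by rewrite scale1r.
by rewrite /= x_anti // IH x_scal exprS mulN1r scaleNr.
Qed.

Lemma iter_scal j m c u : iter m (x j) (c *: u) = c *: iter m (x j) u.
Proof. by elim: m => //= m ->; rewrite x_scal. Qed.

(** Stated for operators and not for elements of a ring, this applies both to
    the module constructed below and to left multiplications in the algebra. *)
Lemma monom_act_step j a u :
  x j (monom_act x a u) = expo_sign K j a *: monom_act x (expo_incr j a) u.
Proof.
rewrite /monom_act /expo_sign.
have: sorted ltn (map val (index_enum 'I_n)).
  by rewrite [index_enum _]unlock -enumT val_enum_ord iota_ltn_sorted.
have: j \in index_enum 'I_n by rewrite mem_index_enum.
rewrite -[\sum_(k < n | _) _]/(\sum_(k <- index_enum 'I_n | (k < j)%N) a k)%N.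
elim: (index_enum 'I_n) => //= i r IH; rewrite inE big_cons.
case: (eqVneq j i) => [<- _ lt_r|ji /= rj lt_r]; last first.
  have lt_ij : (i < j)%N.
    by apply: (allP (order_path_min ltn_trans lt_r)); apply: map_f.
  rewrite lt_ij iter_anticomm // IH // ?(path_sorted lt_r) //.
  rewrite iter_scal scalerA -exprD; congr (_ *: iter _ _ _).
  by rewrite ffunE eq_sym (negbTE ji) addn0.
have lt_jr k : k \in r -> (j < k)%N.
  move=> rk; apply: (allP (order_path_min ltn_trans lt_r)); exact: map_f.
rewrite ltnn big_seq_cond big1 => [|k /andP[/lt_jr lt_jk]]; last first.
  by rewrite ltnNge (ltnW lt_jk).
rewrite scale1r ffunE eqxx addn1 iterS; congr (x j (iter _ _ _)).
elim: r {IH lt_r} lt_jr => //= k r IH lt_jr.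
have /ltn_eqF jk := lt_jr k (mem_head _ _).
rewrite IH => [|l rl]; last by apply: lt_jr; rewrite inE rl orbT.
by rewrite ffunE eq_sym -val_eqE /= jk addn0.
Qed.

Lemma monom_act_incr j a u :
  monom_act x (expo_incr j a) u = expo_sign K j a *: x j (monom_act x a u).
Proof. by rewrite monom_act_step scalerA expo_signK scale1r. Qed.

End Anticommuting.
End MonomialAction.
(** * The bracket operators of a representation of the Weyl group *)

Section Bracket.
Variables (K : fieldType) (X : weyl_type) (n : nat) (t u v : K).
Local Notation W := (weyl X n).
Variables (U : lmodType K) (s : W -> {linear U -> U}).
Implicit Types (i j k : 'I_n) (r w : W) (x : U).

Definition refl_op i j x : U := \sum_(r <- reflections X i j) s r x.

Definition flip_op i x : U := \sum_(r <- sign_flips X i) s r x.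

(** The right-hand side of the relation for the anticommutator of
    [eta i] and [xi j], with the group acting through [s]. *)
Definition bracket i j x : U :=
  if i == j
  then t *: x + u *: (\sum_(k < n | k != i) refl_op k i x) + v *: flip_op i x
  else u *: refl_op i j x.

Lemma refl_op_is_linear i j : linear (refl_op i j).
Proof.
move=> c x y; rewrite /refl_op scaler_sumr -big_split.
by apply: eq_bigr => r _; rewrite linearP.
Qed.
HB.instance Definition _ i j :=
  GRing.isLinear.Build K U U *:%R (refl_op i j) (refl_op_is_linear i j).

Lemma flip_op_is_linear i : linear (flip_op i).
Proof.
move=> c x y; rewrite /flip_op scaler_sumr -big_split.
by apply: eq_bigr => r _; rewrite linearP.
Qed.
HB.instance Definition _ i :=
  GRing.isLinear.Build K U U *:%R (flip_op i) (flip_op_is_linear i).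

Lemma bracket_is_linear i j : linear (bracket i j).
Proof.
move=> c x y; rewrite /bracket; case: eqP => _; last first.
  by rewrite linearP scalerDr !scalerA mulrC.
have -> : \sum_(k < n | k != i) refl_op k i (c *: x + y)
    = c *: (\sum_(k < n | k != i) refl_op k i x)
      + \sum_(k < n | k != i) refl_op k i y.
  by rewrite scaler_sumr -big_split; apply: eq_bigr => k _; rewrite linearP.
rewrite (linearP (flip_op i)) !scalerDr !scalerA ![_ * c]mulrC.
by rewrite [RHS]addrACA; congr (_ + _); apply: addrACA.
Qed.
HB.instance Definition _ i j :=
  GRing.isLinear.Build K U U *:%R (bracket i j) (bracket_is_linear i j).

Lemma bracketC i j x : bracket i j x = bracket j i x.
Proof.
rewrite /bracket eq_sym; case: eqVneq => [-> //|ji].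
by rewrite /refl_op reflectionsC // eq_sym.
Qed.

Hypothesis sM : forall w r x, s w (s r x) = s (r * w)%g x.

Lemma act_conj w r x : s w (s r x) = s (r ^ w)%g (s w x).
Proof. by rewrite !sM -conjgC. Qed.

Lemma refl_op_equivariant w i j x : i != j ->
  s w (refl_op i j x) = refl_op (forget_signs w i) (forget_signs w j) (s w x).
Proof.
move=> ij; rewrite /refl_op -(perm_big _ (reflections_conj w ij)) /=.
by rewrite big_map raddf_sum; apply: eq_bigr => r _; apply: act_conj.
Qed.

Lemma flip_op_equivariant w i x :
  s w (flip_op i x) = flip_op (forget_signs w i) (s w x).
Proof.
rewrite /flip_op -sign_flips_conj big_map raddf_sum.
by apply: eq_bigr => r _; apply: act_conj.
Qed.

Lemma bracket_equivariant w i j x :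
  s w (bracket i j x) = bracket (forget_signs w i) (forget_signs w j) (s w x).
Proof.
rewrite /bracket (inj_eq perm_inj); case: eqVneq => [_|ij]; last first.
  by rewrite linearZ /= refl_op_equivariant.
rewrite !linearD !linearZ /= flip_op_equivariant raddf_sum.
congr (_ + _ *: _ + _); rewrite [RHS](reindex_perm (forget_signs w)).
apply: eq_big => [k|k]; first by rewrite (inj_eq perm_inj).
exact: refl_op_equivariant.
Qed.

Variable y : 'I_n -> {linear U -> U}.
Hypothesis y_equivariant :
  forall w j x, s w (y j x) = y (forget_signs w j) (s w x).

Lemma refl_op_equivariant_op i j k x : i != j ->
  refl_op i j (y k x) = y (tperm i j k) (refl_op i j x).
Proof.
move=> ij; rewrite /refl_op raddf_sum big_seq [RHS]big_seq.
apply: eq_bigr => r /(forget_signs_reflection ij) <-; exact: y_equivariant.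
Qed.

Lemma flip_op_equivariant_op i k x : flip_op i (y k x) = y k (flip_op i x).
Proof.
rewrite /flip_op raddf_sum big_seq [RHS]big_seq.
by apply: eq_bigr => r ri; rewrite y_equivariant (forget_signs_flip _ ri).
Qed.

Lemma bracket_commutator_neq i j k x : i != j -> i != k -> j != k ->
  bracket i j (y k x) = y k (bracket i j x).
Proof.
move=> ij ik jk; rewrite /bracket (negbTE ij) refl_op_equivariant_op //.
by rewrite tpermD // linearZ.
Qed.

Lemma bracket_commutator_eq i k x : i != k ->
  bracket i i (y k x) - y k (bracket i i x)
  = u *: (y i (refl_op i k x) - y k (refl_op i k x)).
Proof.
move=> ik; rewrite /bracket eqxx flip_op_equivariant_op.
have yZ c a : y k (c *: a) = c *: y k a by rewrite linearZ.
rewrite !(linearD (y k)) !yZ.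
have ki : k != i by rewrite eq_sym.
rewrite opprD addrACA subrr addr0 opprD addrACA subrr add0r -scalerBr.
congr (_ *: _); rewrite (bigD1 k) //= [X in _ - y k X](bigD1 k) //=.
rewrite refl_op_equivariant_op // tpermL linearD /= opprD addrACA.
have -> : refl_op k i x = refl_op i k x by rewrite /refl_op reflectionsC.
rewrite -[RHS]addr0; congr (_ + _).
rewrite raddf_sum -sumrB big1 // => l /andP[li lk].
by rewrite refl_op_equivariant_op // tpermD ?subrr // eq_sym.
Qed.

(** This is the super Jacobi identity for one [eta] and two [xi], or the other
    way round.  If [i] differs from [j] and [k], both commutators vanish, as
    the transposition of [i] and [j] fixes [k].  If [i = j], only the
    reflections exchanging [j] and [k] contribute: they occur in the diagonal
    bracket [bracket i i] and in [bracket i k], and their commutators are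
    [y j - y k] times the reflection with opposite signs. *)
Lemma bracket_jacobi i j k x : j != k ->
  (bracket i j (y k x) - y k (bracket i j x))
  + (bracket i k (y j x) - y j (bracket i k x)) = 0.
Proof.
wlog: j k / i != k => [H jk|ik jk].
  case: (eqVneq i k) => [ik|]; last by move/H; apply.
  by rewrite addrC H // ?ik // eq_sym.
case: (eqVneq i j) jk => [<- _|ij jk]; last first.
  by rewrite !bracket_commutator_neq // ?subrr ?addr0 // eq_sym.
rewrite bracket_commutator_eq // /bracket (negbTE ik) refl_op_equivariant_op //.
by rewrite tpermL linearZ /= -scalerBr -scalerDr addrC subrKA subrr scaler0.
Qed.

End Bracket.
(** * The representation on an induced module *)

Section FreeSpace.
Variables (K : fieldType) (T : choiceType).

Lemma malg_ind (P : {malg K[T]} -> Prop) :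
  P 0 -> (forall c x y, P x -> P y -> P (c *: x + y)) ->
  (forall k, P << k >>) -> forall x, P x.
Proof.
move=> P0 PD PU x; rewrite [x]monalgE; apply: big_ind => // [y z Py Pz|k _].
  by rewrite -[y]scale1r; apply: PD.
have -> : << x@_k *g k >> = x@_k *: << k >> + 0.
  by apply/malgP => l; rewrite addr0 mcoeffZ !mcoeffU mulr_natr.
exact: PD.
Qed.

Lemma lin_ext_basis (V : lmodType K) (f : T -> V) k :
  lin_ext f << k >> = f k.
Proof. by rewrite lin_extU scale1r. Qed.

End FreeSpace.

Lemma jacobi_rearrange (V : zmodType) (a b c c' d e : V) : c + c' = 0 ->
  (a - (b - c)) + (d - (e - c')) = (a - e) + (d - b).
Proof.
move=> cc'; rewrite !opprB addrACA [X in _ + X]addrACA cc' add0r.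
by rewrite [RHS]addrACA [X in _ + X]addrC.
Qed.

Section InducedModule.
Variables (K : fieldType) (X : weyl_type) (n : nat) (t u v : K).
Local Notation W := (weyl X n).
Local Notation expo := {ffun 'I_n -> nat}.
Variables (V : lmodType K) (xi_op : 'I_n -> {linear V -> V}).
Variable vac : W -> expo -> V.
Implicit Types (a b : expo) (w r : W) (x : V) (i j k : 'I_n).

(** [V] is the module over the skew polynomials in the [xi] induced from the
    space with basis [vac w b], which stands for [w eta^b]: it is generated by
    that basis, and maps out of it are determined freely on that basis. *)
Hypothesis xi_op_anticomm :
  forall i j x, i != j -> xi_op i (xi_op j x) = - xi_op j (xi_op i x).
Hypothesis vac_ind : forall P : V -> Prop,
  (forall c x y, P x -> P y -> P (c *: x + y)) ->
  (forall w b, P (vac w b)) ->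
  (forall j x, P x -> P (xi_op j x)) -> forall x, P x.
Hypothesis vac_rec :
  forall (U : lmodType K) (y : 'I_n -> {linear U -> U}) (f : W -> expo -> U),
  (forall i j z, i != j -> y i (y j z) = - y j (y i z)) ->
  {g : {linear V -> U} | (forall w b, g (vac w b) = f w b)
                       /\ (forall j x, g (xi_op j x) = y j (g x))}.

(** The group acts by [w (xi_j x) = xi_(w j) (w x)]; this determines the action
    from the one on the generating vectors. *)
Lemma weyl_op_spec w : {g : {linear V -> V} |
  (forall r b, g (vac r b) = vac (r * w)%g b)
  /\ (forall j x, g (xi_op j x) = xi_op (forget_signs w j) (g x))}.
Proof.
apply: (vac_rec (y := fun j => xi_op (forget_signs w j))) => i j z ij.
by apply: xi_op_anticomm; rewrite (inj_eq perm_inj).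
Qed.

Definition weyl_op w : {linear V -> V} := sval (weyl_op_spec w).

Lemma weyl_op_vac w r b : weyl_op w (vac r b) = vac (r * w)%g b.
Proof. by case: (svalP (weyl_op_spec w)). Qed.

Lemma weyl_op_xi w j x :
  weyl_op w (xi_op j x) = xi_op (forget_signs w j) (weyl_op w x).
Proof. by case: (svalP (weyl_op_spec w)). Qed.

Lemma weyl_op1 x : weyl_op 1%g x = x.
Proof.
elim/vac_ind: x => [c x y ex ey|w b|j x ex].
- by rewrite linearP ex ey.
- by rewrite weyl_op_vac mulg1.
- by rewrite weyl_op_xi forget_signs1 ex.
Qed.

Lemma weyl_opM w r x : weyl_op w (weyl_op r x) = weyl_op (r * w)%g x.
Proof.
elim/vac_ind: x => [c x y ex ey|q b|j x ex].
- by rewrite !linearP ex ey.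
- by rewrite !weyl_op_vac mulgA.
- by rewrite !weyl_op_xi ex forget_signsM permM.
Qed.

Local Notation A := (bracket t u v weyl_op).

(** The value of [eta i] on [w eta^b], obtained by moving [eta i] to its place
    in the monomial. *)
Definition eta_vac i w b : V :=
  let k := (forget_signs w)^-1%g i in
  expo_sign K k b *: vac w (expo_incr k b).

Definition eta_xi_step i j (p : V * V) : V * V :=
  (A i j p.2 - xi_op j p.1, xi_op j p.2).

Lemma eta_xi_step_is_linear i j : linear (eta_xi_step i j).
Proof.
move=> c p q; rewrite /eta_xi_step !linearP; congr (_, _).
by rewrite [RHS]/= [in RHS]scalerDr addrACA.
Qed.
HB.instance Definition _ i j := GRing.isLinear.Build K (V * V)%type (V * V)%type
  *:%R (eta_xi_step i j) (eta_xi_step_is_linear i j).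

Lemma eta_xi_step_anticomm i j k p : j != k ->
  eta_xi_step i j (eta_xi_step i k p) = - eta_xi_step i k (eta_xi_step i j p).
Proof.
move=> jk; rewrite /eta_xi_step; congr (_, _); last exact: xi_op_anticomm.
have J := bracket_jacobi t u v weyl_op_xi i p.2 jk.
have xiB l x z : xi_op l (x - z) = xi_op l x - xi_op l z by rewrite raddfB.
apply/eqP; rewrite -subr_eq0 opprK -J /= !xiB.
have -> : xi_op k (xi_op j p.1) = - xi_op j (xi_op k p.1).
  by apply: xi_op_anticomm; rewrite eq_sym.
by rewrite jacobi_rearrange // addrN.
Qed.

Lemma eta_pair_spec i : {g : {linear V -> (V * V)%type} |
  (forall w b, g (vac w b) = (eta_vac i w b, vac w b))
  /\ (forall j x, g (xi_op j x) = eta_xi_step i j (g x))}.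
Proof. exact/vac_rec/eta_xi_step_anticomm. Qed.

(** Reading the relation for [eta i] and [xi j] as the rule
    [eta i (xi j x) = A i j x - xi j (eta i x)] makes the pair [(eta i x, x)]
    the value at [x] of a map out of the induced module. *)
Definition eta_pair i : {linear V -> (V * V)%type} := sval (eta_pair_spec i).

Lemma eta_pair_vac i w b : eta_pair i (vac w b) = (eta_vac i w b, vac w b).
Proof. by case: (svalP (eta_pair_spec i)). Qed.

Lemma eta_pair_xi i j x :
  eta_pair i (xi_op j x) = eta_xi_step i j (eta_pair i x).
Proof. by case: (svalP (eta_pair_spec i)). Qed.

Lemma eta_pair2 i x : (eta_pair i x).2 = x.
Proof.
elim/vac_ind: x => [c x y ex ey|w b|j x ex].
- by rewrite linearP /= ex ey.
- by rewrite eta_pair_vac.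
- by rewrite eta_pair_xi /= ex.
Qed.

Definition eta_op i x : V := (eta_pair i x).1.

Lemma eta_op_is_linear i : linear (eta_op i).
Proof. by move=> c x y; rewrite /eta_op linearP. Qed.
HB.instance Definition _ i :=
  GRing.isLinear.Build K V V *:%R (eta_op i) (eta_op_is_linear i).

Lemma eta_op_vac i w b : eta_op i (vac w b) = eta_vac i w b.
Proof. by rewrite /eta_op eta_pair_vac. Qed.

Lemma eta_op_xi i j x : eta_op i (xi_op j x) = A i j x - xi_op j (eta_op i x).
Proof. by rewrite /eta_op eta_pair_xi /= eta_pair2. Qed.

Lemma weyl_op_eta w i x :
  weyl_op w (eta_op i x) = eta_op (forget_signs w i) (weyl_op w x).
Proof.
elim/vac_ind: x => [c x y ex ey|r b|j x ex].
- by rewrite !linearP /= ex ey.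
- rewrite weyl_op_vac !eta_op_vac /eta_vac linearZ /= weyl_op_vac.
  by rewrite forget_signsM invMg permM permK.
- rewrite eta_op_xi weyl_op_xi eta_op_xi raddfB /= weyl_op_xi ex.
  by rewrite (bracket_equivariant t u v weyl_opM).
Qed.

Lemma eta_op_anticomm i j x :
  i != j -> eta_op i (eta_op j x) = - eta_op j (eta_op i x).
Proof.
move=> ij; elim/vac_ind: x => [c x y ex ey|w b|k x ex].
- by rewrite !linearP /= ex ey scalerN -opprD.
- rewrite !eta_op_vac !linearZ /= !eta_op_vac /eta_vac !scalerN !scalerA.
  rewrite expo_incrC mulrC expo_sign_anticomm ?(inj_eq perm_inj) //.
  by rewrite scaleNr mulrC.
- have etaB l y z : eta_op l (y - z) = eta_op l y - eta_op l z.
    by rewrite raddfB.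
  have xiN z : xi_op k (- z) = - xi_op k z by rewrite raddfN.
  have := bracket_jacobi t u v weyl_op_eta k x ij.
  rewrite !(bracketC _ _ _ _ k) => J.
  apply/eqP; rewrite -subr_eq0 opprK !eta_op_xi !etaB !eta_op_xi ex xiN.
  rewrite -oppr0 -J jacobi_rearrange; last by rewrite addNr.
  by rewrite opprD !opprB addrC.
Qed.

End InducedModule.
(** * Representations of the free algebra *)

Section FreeAlgebraAction.
Variables (K : fieldType) (I : choiceType).
Local Notation F := (free_alg K I).

Lemma free_word_ind (P : F -> Prop) :
  (forall c p q, P p -> P q -> P (c *: p + q)) ->
  (forall m p, free_val p = << m >> -> P p) -> forall p, P p.
Proof.
move=> PD PU; pose Q g := exists2 p : F, free_val p = g & P p.
suff Qg g : Q g.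
  by move=> p; case: (Qg (free_val p)) => q /val_inj <-.
elim/malg_ind: g => [|c x y [p <- Pp] [q <- Pq]|m].
- exists 0; first exact: raddf0.
  by rewrite -(subrr 1) addrC -scaleN1r; apply: PD; apply: (PU (fmone I)).
- by exists (c *: p + q); [rewrite linearP|apply: PD].
by exists (FreeAlg << m >>); last exact: (PU m).
Qed.

Lemma free_val_genM (i : I) (p : F) (m : {fmonom I}) :
  free_val p = << m >> -> free_val (free_gen K i * p) = << mmul (fmu i) m >>.
Proof.
by move=> vp; rewrite rmorphM /= free_val_gen vp malgM_def fgmulUU mulr1.
Qed.

(** Induction on words, read from their first letter. *)
Lemma free_alg_ind (P : F -> Prop) :
  (forall c p q, P p -> P q -> P (c *: p + q)) -> P 1 ->
  (forall i p, P p -> P (free_gen K i * p)) -> forall p, P p.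
Proof.
move=> PD P1 PM; apply: free_word_ind => // -[m].
elim: m => [|i m IH] p vp.
  suff -> : p = 1 by [].
  apply: val_inj; rewrite [LHS]vp [RHS](rmorph1 (@free_val K I)).
  by congr << _ >>; rewrite -fmoneE.
have vq : free_val (FreeAlg << FMonom m >> : F) = << FMonom m >> by [].
suff -> : p = free_gen K i * FreeAlg << FMonom m >> by apply/PM/(IH _ vq).
apply: val_inj; rewrite [RHS](free_val_genM i vq) [LHS]vp; congr << _ >>.
by apply/val_inj; rewrite /= fmM fmU.
Qed.

Variables (V : lmodType K) (op : I -> {linear V -> V}).
Implicit Types (p q : F) (x : V).

Definition free_act p x : V :=
  lin_ext (fun m : {fmonom I} => foldr (fun i => op i) x (m : seq I))
          (free_val p).

Lemma free_actP c p q x :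
  free_act (c *: p + q) x = c *: free_act p x + free_act q x.
Proof. by rewrite /free_act !linearP. Qed.

Definition free_act_at x p : V := free_act p x.
HB.instance Definition _ x := GRing.isLinear.Build K F V *:%R (free_act_at x)
  (fun c p q => free_actP c p q x).

Lemma free_act1 x : free_act 1 x = x.
Proof. by rewrite /free_act rmorph1 lin_ext_basis fm1. Qed.

Lemma free_act_gen i x : free_act (free_gen K i) x = op i x.
Proof. by rewrite /free_act free_val_gen lin_ext_basis fmU. Qed.

Lemma free_act_genM i p x : free_act (free_gen K i * p) x = op i (free_act p x).
Proof.
elim/free_word_ind: p => [c p q ep eq|m p vp].
  by rewrite mulrDr -scalerAr !free_actP ep eq linearP.
by rewrite /free_act (free_val_genM i vp) vp !lin_ext_basis fmM fmU.
Qed.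

Lemma free_actM p q x : free_act (p * q) x = free_act p (free_act q x).
Proof.
elim/free_alg_ind: p => [c p p' ep ep'||i p ep].
- by rewrite mulrDl -scalerAl !free_actP ep ep'.
- by rewrite mul1r free_act1.
- by rewrite -mulrA !free_act_genM ep.
Qed.

Lemma free_act_is_linear p : linear (free_act p).
Proof.
move=> c x y.
elim/free_alg_ind: p x y => [d p q ep eq x y|x y|i p ep x y].
- rewrite !free_actP ep eq !scalerDr addrACA !scalerA.
  by rewrite [d * c]mulrC.
- by rewrite !free_act1.
- by rewrite !free_act_genM ep linearP.
Qed.

HB.instance Definition _ p :=
  GRing.isLinear.Build K V V *:%R (free_act p) (free_act_is_linear p).

Lemma free_act_ideal (rel : F -> F -> Prop) p :
  (forall q r x, rel q r -> free_act q x = free_act r x) ->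
  in_ideal rel p -> forall x, free_act p x = 0.
Proof.
move=> act_rel Ip x; rewrite -/(free_act_at x p).
elim: Ip x => {p} [p q /act_rel e|x|p q _ ep _ eq x|p q _ e x|p q _ e x].
- by move=> x; rewrite raddfB /= [free_act_at x p]e subrr.
- exact: raddf0.
- by rewrite raddfD /= ep eq addr0.
- by rewrite [LHS]free_actM [free_act q x]e raddf0.
- by rewrite [LHS]free_actM; apply: e.
Qed.

End FreeAlgebraAction.

Section DefiningRelations.
Variables (K : fieldType) (X : weyl_type) (n : nat) (t u v : K).
Local Notation W := (weyl X n).
Local Notation F := (free_alg K (daha_gen X n)).
Implicit Types (i j : 'I_n).

Lemma refl_sumE i j :
  refl_sum K X i j = \sum_(r <- reflections X i j) free_weyl K r.
Proof.
by rewrite /refl_sum /reflections; case: X; rewrite !big_cons big_nil addr0.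
Qed.

Lemma flip_termE i :
  flip_term X v i = v *: \sum_(r <- sign_flips X i) free_weyl K r.
Proof.
rewrite /flip_term /sign_flips.
by case: X; rewrite ?big_cons big_nil ?addr0 ?scaler0.
Qed.

Definition daha_rhs i j : F :=
  if i == j
  then t%:A + u *: (\sum_(k < n | k != i) refl_sum K X k i) + flip_term X v i
  else u *: refl_sum K X i j.

(** Here [ev p] stands for the result of applying [p] to [x]; it is used for
    the action on the module and for left multiplication in the algebra. *)
Lemma daha_rhs_bracket (U : lmodType K) (s : W -> {linear U -> U})
    (ev : {linear F -> U}) (x : U) i j :
  ev 1 = x -> (forall w, ev (free_weyl K w) = s w x) ->
  ev (daha_rhs i j) = bracket t u v s i j x.
Proof.
move=> ev1 evw.
have ev_refl k l : ev (refl_sum K X k l) = refl_op s k l x.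
  by rewrite refl_sumE raddf_sum; apply: eq_bigr => r _; apply: evw.
rewrite /daha_rhs /bracket; case: eqP => _; last by rewrite linearZ ev_refl.
rewrite flip_termE !linearD !linearZ /= ev1 !(raddf_sum ev).
by congr (_ + _ *: _ + _ *: _); apply: eq_bigr => r _;
  [apply: ev_refl|apply: evw].
Qed.

End DefiningRelations.
(** * Linear independence of the monomials *)

Section DahaModule.
Variables (K : fieldType) (X : weyl_type) (n : nat) (t u v : K).
Local Notation W := (weyl X n).
Local Notation F := (free_alg K (daha_gen X n)).
Local Notation H := (odd_daha X n t u v).
Variables (V : lmodType K) (xi_op eta_op : 'I_n -> {linear V -> V}).
Variable weyl_op : W -> {linear V -> V}.
Implicit Types (i j : 'I_n) (w r : W) (x : V).

Hypothesis xi_op_anticomm :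
  forall i j x, i != j -> xi_op i (xi_op j x) = - xi_op j (xi_op i x).
Hypothesis eta_op_anticomm :
  forall i j x, i != j -> eta_op i (eta_op j x) = - eta_op j (eta_op i x).
Hypothesis weyl_op1 : forall x, weyl_op 1%g x = x.
Hypothesis weyl_opM :
  forall w r x, weyl_op w (weyl_op r x) = weyl_op (r * w)%g x.
Hypothesis weyl_op_xi : forall w j x,
  weyl_op w (xi_op j x) = xi_op (forget_signs w j) (weyl_op w x).
Hypothesis weyl_op_eta : forall w j x,
  weyl_op w (eta_op j x) = eta_op (forget_signs w j) (weyl_op w x).
Hypothesis eta_op_xi : forall i j x,
  eta_op i (xi_op j x) = bracket t u v weyl_op i j x - xi_op j (eta_op i x).

Definition gen_op (g : daha_gen X n) : {linear V -> V} :=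
  match g with
  | inl (inl i) => xi_op i
  | inl (inr i) => eta_op i
  | inr w => weyl_op w
  end.

Lemma act_xi i x : free_act gen_op (free_xi K X i) x = xi_op i x.
Proof. exact: free_act_gen. Qed.
Lemma act_eta i x : free_act gen_op (free_eta K X i) x = eta_op i x.
Proof. exact: free_act_gen. Qed.
Lemma act_weyl w x : free_act gen_op (free_weyl K w) x = weyl_op w x.
Proof. exact: free_act_gen. Qed.

Lemma gen_op_rel p q x :
  daha_rel t u v p q -> free_act gen_op p x = free_act gen_op q x.
Proof.
have actD a b y :
    free_act gen_op (a + b) y = free_act gen_op a y + free_act gen_op b y.
  exact: (raddfD (free_act_at gen_op y)).
have actN a y : free_act gen_op (- a) y = - free_act gen_op a y.
  exact: (raddfN (free_act_at gen_op y)).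
have act_rhs i j y :
    free_act gen_op (daha_rhs X t u v i j) y = bracket t u v weyl_op i j y.
  apply: (daha_rhs_bracket t u v (ev := free_act_at gen_op y)).
    exact: free_act1.
  by move=> w; apply: act_weyl.
have anti i j y : free_act gen_op (anticomm (free_eta K X i) (free_xi K X j)) y
    = bracket t u v weyl_op i j y.
  by rewrite actD !free_actM !act_xi !act_eta eta_op_xi subrK.
case=> {p q} [i j ij|i j ij||w r|w j|w j|i j ij|i].
- by rewrite actN !free_actM !act_eta eta_op_anticomm.
- by rewrite actN !free_actM !act_xi xi_op_anticomm.
- by rewrite act_weyl free_act1 weyl_op1.
- by rewrite free_actM !act_weyl weyl_opM.
- by rewrite !free_actM !act_xi !act_weyl ?act_xi weyl_op_xi.
- by rewrite !free_actM !act_eta !act_weyl ?act_eta weyl_op_eta.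
- by rewrite anti -act_rhs /daha_rhs (negbTE ij).
- by rewrite anti -act_rhs /daha_rhs eqxx.
Qed.

Definition daha_orbit_map (x0 : V) (h : H) : V :=
  free_act gen_op (alg_repr h) x0.

Lemma daha_orbit_mapE x0 p :
  daha_orbit_map x0 (daha_pi t u v p) = free_act gen_op p x0.
Proof.
apply/eqP; rewrite -subr_eq0; apply/eqP.
rewrite -[RHS](free_act_ideal gen_op_rel
  (alg_reprP (daha_rel t u v) p) x0).
by rewrite -[RHS]/(free_act_at gen_op x0 _) raddfB.
Qed.

Lemma daha_orbit_map_is_linear x0 : linear (daha_orbit_map x0).
Proof.
move=> c h k; rewrite -[h]alg_reprK -[k]alg_reprK -linearP /=.
by rewrite ![daha_orbit_map _ _]daha_orbit_mapE free_actP.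
Qed.
Lemma act_ord_monom (f : 'I_n -> F) (op : 'I_n -> V -> V) a x :
  (forall i y, free_act gen_op (f i) y = op i y) ->
  free_act gen_op (ord_monom f a) x = monom_act op a x.
Proof.
move=> fop; rewrite /ord_monom /monom_act.
elim: index_enum => [|i r IH]; first by rewrite big_nil free_act1.
rewrite big_cons free_actM {}IH /=; elim: (a i) => [|m IH] /=.
  exact: free_act1.
by rewrite exprS free_actM IH.
Qed.

Lemma daha_orbit_monom x0 :
  exists phi : {linear H -> V}, forall a w b,
    phi (ord_monom (Xi X t u v) a * Weyl t u v w * ord_monom (Eta X t u v) b)
    = monom_act xi_op a (weyl_op w (monom_act eta_op b x0)).
Proof.
pose L := GRing.isLinear.Build K H V *:%R _ (daha_orbit_map_is_linear x0).
exists (HB.pack_for {linear H -> V} (daha_orbit_map x0) L) => a w b /=.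
have -> : ord_monom (Xi X t u v) a * Weyl t u v w * ord_monom (Eta X t u v) b
    = daha_pi t u v (ord_monom (free_xi K X) a * free_weyl K w
                     * ord_monom (free_eta K X) b).
  rewrite /daha_pi !rmorphM /ord_monom !rmorph_prod.
  by congr (_ * _ * _); apply: eq_bigr => i _; rewrite rmorphXn.
rewrite daha_orbit_mapE !free_actM act_weyl.
by rewrite (act_ord_monom _ _ act_xi) (act_ord_monom _ _ act_eta).
Qed.

End DahaModule.

Section Coordinates.
Variables (K : fieldType) (X : weyl_type) (n : nat) (t u v : K).
Local Notation W := (weyl X n).
Local Notation expo := {ffun 'I_n -> nat}.
Variables (V : lmodType K) (xi_op : 'I_n -> {linear V -> V}).
Variable vac : W -> expo -> V.

Hypothesis xi_op_anticomm :
  forall i j x, i != j -> xi_op i (xi_op j x) = - xi_op j (xi_op i x).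
Hypothesis vac_ind : forall P : V -> Prop,
  (forall c x y, P x -> P y -> P (c *: x + y)) ->
  (forall w b, P (vac w b)) ->
  (forall j x, P x -> P (xi_op j x)) -> forall x, P x.
Hypothesis vac_rec :
  forall (U : lmodType K) (y : 'I_n -> {linear U -> U}) (f : W -> expo -> U),
  (forall i j z, i != j -> y i (y j z) = - y j (y i z)) ->
  {g : {linear V -> U} | (forall w b, g (vac w b) = f w b)
                       /\ (forall j x, g (xi_op j x) = y j (g x))}.

(** The map is the orbit map of [vac 1 0], the vector standing for [1]. *)
Lemma pbw_coordinates :
  exists phi : {linear odd_daha X n t u v -> V}, forall a w b,
    phi (ord_monom (Xi X t u v) a * Weyl t u v w * ord_monom (Eta X t u v) b)
    = monom_act xi_op a (vac w b).
Proof.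
pose wop := weyl_op xi_op_anticomm vac_rec.
pose eop i : {linear V -> V} := eta_op t u v xi_op_anticomm vac_rec i.
have xi_anti := xi_op_anticomm.
have eta_anti i j x : i != j -> eop i (eop j x) = - eop j (eop i x).
  exact: eta_op_anticomm.
have wop1 : forall x, wop 1%g x = x by apply: weyl_op1.
have wopM : forall w r x, wop w (wop r x) = wop (r * w)%g x by apply: weyl_opM.
have wop_xi w j x : wop w (xi_op j x) = xi_op (forget_signs w j) (wop w x).
  exact: weyl_op_xi.
have wop_eta w j x : wop w (eop j x) = eop (forget_signs w j) (wop w x).
  exact: weyl_op_eta.
have eop_xi i j x :
    eop i (xi_op j x) = bracket t u v wop i j x - xi_op j (eop i x).
  exact: eta_op_xi.
have [phi phiE] := daha_orbit_monom xi_anti eta_anti wop1 wopM wop_xi wop_eta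
  eop_xi (vac 1%g (expo0 n)).
exists phi => a w b; rewrite phiE; congr (monom_act _ _ _).
have -> : monom_act eop b (vac 1%g (expo0 n)) = vac 1%g b.
  elim/expo_ind: b => [|j b IH]; first exact: monom_act0.
  rewrite monom_act_incr ?IH //; last by move=> i c x; rewrite linearZ.
  rewrite [eop j _]eta_op_vac /eta_vac.
  have -> : (forget_signs (1%g : W))^-1%g j = j.
    by apply: (canLR (permK _)); rewrite forget_signs1.
  by rewrite scalerA expo_signK scale1r.
by rewrite [LHS]weyl_op_vac mul1g.
Qed.

End Coordinates.

Section BasedSpace.
Variables (K : fieldType) (X : weyl_type) (n : nat).
Local Notation W := (weyl X n).
Local Notation expo := {ffun 'I_n -> nat}.
Variables (V : lmodType K) (vec : expo -> W -> expo -> V).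
Implicit Types (a b : expo) (w : W) (x : V) (i j : 'I_n).

(** [V] has the basis [vec a w b], which stands for [xi^a w eta^b]; being a
    basis is expressed by induction and by the definition of linear maps. *)
Hypothesis vec_ind : forall P : V -> Prop,
  (forall c x y, P x -> P y -> P (c *: x + y)) ->
  (forall a w b, P (vec a w b)) -> forall x, P x.
Hypothesis vec_rec : forall (U : lmodType K) (f : expo -> W -> expo -> U),
  {g : {linear V -> U} | forall a w b, g (vec a w b) = f a w b}.

Definition pbw_xi j : {linear V -> V} :=
  sval (vec_rec (fun a w b => expo_sign K j a *: vec (expo_incr j a) w b)).

Lemma pbw_xiE j a w b :
  pbw_xi j (vec a w b) = expo_sign K j a *: vec (expo_incr j a) w b.
Proof. by rewrite (svalP (vec_rec _)). Qed.

Lemma pbw_xi_anticomm i j x :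
  i != j -> pbw_xi i (pbw_xi j x) = - pbw_xi j (pbw_xi i x).
Proof.
move=> ij; elim/vec_ind: x => [c x y ex ey|a w b].
  by rewrite !linearP /= ex ey scalerN -opprD.
rewrite !pbw_xiE !linearZ /= !pbw_xiE !scalerN !scalerA.
by rewrite expo_incrC mulrC expo_sign_anticomm // scaleNr mulrC.
Qed.

Lemma pbw_ind (P : V -> Prop) :
  (forall c x y, P x -> P y -> P (c *: x + y)) ->
  (forall w b, P (vec (expo0 n) w b)) ->
  (forall j x, P x -> P (pbw_xi j x)) -> forall x, P x.
Proof.
move=> PD Pvac Pxi.
have P0 : P 0.
  rewrite -(subrr (vec (expo0 n) 1%g (expo0 n))) addrC -scaleN1r.
  by apply: PD; apply: Pvac.
apply: vec_ind => // a w b; elim/expo_ind: a => [|j a Pa]; first exact: Pvac.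
have -> : vec (expo_incr j a) w b = expo_sign K j a *: pbw_xi j (vec a w b) + 0.
  by rewrite pbw_xiE scalerA expo_signK scale1r addr0.
by apply: PD => //; apply: Pxi.
Qed.

Lemma pbw_rec (U : lmodType K) (y : 'I_n -> {linear U -> U})
    (f : W -> expo -> U) :
  (forall i j z, i != j -> y i (y j z) = - y j (y i z)) ->
  {g : {linear V -> U} | (forall w b, g (vec (expo0 n) w b) = f w b)
                       /\ (forall j x, g (pbw_xi j x) = y j (g x))}.
Proof.
move=> y_anti; have [g gE] := vec_rec (fun a w b => monom_act y a (f w b)).
exists g; split=> [w b|j x]; first by rewrite gE monom_act0.
elim/vec_ind: x => [c x z ex ez|a w b]; first by rewrite !linearP /= ex ez.
rewrite pbw_xiE linearZ /= !gE monom_act_incr ?scalerA ?expo_signK ?scale1r //.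
by move=> i c z; rewrite linearZ.
Qed.

Lemma pbw_xi_monom a w b :
  monom_act pbw_xi a (vec (expo0 n) w b) = vec a w b.
Proof.
elim/expo_ind: a => [|j a IH]; first exact: monom_act0.
rewrite monom_act_incr ?IH ?pbw_xiE ?scalerA ?expo_signK ?scale1r //.
- by move=> i c x; rewrite linearZ.
- exact: pbw_xi_anticomm.
Qed.

Lemma based_coordinates (t u v : K) :
  exists phi : {linear odd_daha X n t u v -> V}, forall a w b,
    phi (ord_monom (Xi X t u v) a * Weyl t u v w * ord_monom (Eta X t u v) b)
    = vec a w b.
Proof.
have [phi phiE] := pbw_coordinates t u v pbw_xi_anticomm pbw_ind pbw_rec.
by exists phi => a w b; rewrite phiE pbw_xi_monom.
Qed.

End BasedSpace.

Section PBWMonomials.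
Variables (K : fieldType) (X : weyl_type) (n : nat) (t u v : K).
Local Notation W := (weyl X n).
Local Notation expo := {ffun 'I_n -> nat}.
Local Notation index := (expo * W * expo)%type.
Local Notation H := (odd_daha X n t u v).

Definition pbw_monom (abs : index) : H :=
  ord_monom (Xi X t u v) abs.1.1 * Weyl t u v abs.1.2
  * ord_monom (Eta X t u v) abs.2.

Lemma pbw_monom_free (c : {malg K[index]}) : lin_ext pbw_monom c = 0 -> c = 0.
Proof.
pose vec a w b : {malg K[index]} := << ((a, w, b) : index) >>.
have vec_ind (P : {malg K[index]} -> Prop) :
    (forall d x y, P x -> P y -> P (d *: x + y)) ->
    (forall a w b, P (vec a w b)) -> forall x, P x.
  move=> PD Pv; apply: malg_ind => // [|[[a w] b]]; last exact: Pv.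
  have := PD (-1) _ _ (Pv (expo0 n) 1%g (expo0 n)) (Pv (expo0 n) 1%g (expo0 n)).
  by rewrite scaleN1r addNr.
have vec_rec (U : lmodType K) (f : expo -> W -> expo -> U) :
    {g : {linear {malg K[index]} -> U} | forall a w b, g (vec a w b) = f a w b}.
  exists (lin_ext (fun m : index => f m.1.1 m.1.2 m.2)) => a w b.
  exact: lin_ext_basis.
have [phi phiE] := based_coordinates vec_ind vec_rec t u v.
suff phiK x : phi (lin_ext pbw_monom x) = x.
  by move=> c0; rewrite -(phiK c) c0 raddf0.
elim/vec_ind: x => [d x y ex ey|a w b]; last by rewrite lin_ext_basis phiE.
rewrite (linearP (lin_ext pbw_monom)) linearP.
by rewrite [phi _]ex [phi (lin_ext _ y)]ey.
Qed.

End PBWMonomials.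
(** * Spanning families *)

Section Spanning.
Variable K : fieldType.

Definition spanned (V : lmodType K) (T : Type) (e : T -> V) (x : V) : Prop :=
  in_span (fun y => exists k, y = e k) x.

Lemma spanned_gen (V : lmodType K) (T : Type) (e : T -> V) k : spanned e (e k).
Proof. by apply: in_span_gen; exists k. Qed.

Lemma spannedN (V : lmodType K) (T : Type) (e : T -> V) x :
  spanned e x -> spanned e (- x).
Proof. by rewrite -scaleN1r; apply: in_spanZ. Qed.

Lemma spanned_sum (V : lmodType K) (T I : Type) (e : T -> V) (r : seq I)
    (P : pred I) (f : I -> V) :
  (forall i, P i -> spanned e (f i)) -> spanned e (\sum_(i <- r | P i) f i).
Proof.
by move=> ef; apply: big_ind => //; [apply: in_span0|apply: in_spanD].
Qed.

Lemma spanned_map (U V : lmodType K) (T T' : Type) (e : T -> U) (e' : T' -> V)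
    (f : {linear U -> V}) x :
  (forall k, spanned e' (f (e k))) -> spanned e x -> spanned e' (f x).
Proof.
move=> fe; elim=> {x} [_ [k ->]||x y _ ex _ ey|c x _ ex] //.
- by rewrite raddf0; apply: in_span0.
- by rewrite raddfD; apply: in_spanD.
- by rewrite linearZ; apply: in_spanZ.
Qed.

Lemma spanned_lin_ext (V : lmodType K) (T : choiceType) (e : T -> V) x :
  spanned e x -> exists c, x = lin_ext e c.
Proof.
elim=> {x} [_ [k ->]||_ _ _ [c ->] _ [d ->]|a _ _ [c ->]].
- by exists << k >>; rewrite lin_ext_basis.
- by exists 0; rewrite raddf0.
- by exists (c + d); rewrite raddfD.
- by exists (a *: c); rewrite linearZ.
Qed.

End Spanning.

Section QuotientAlgebra.
Variables (K : fieldType) (A : algType K) (rel : A -> A -> Prop).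
Local Notation B := (alg_quot rel).

Definition lmul (g h : B) : B := g * h.

Lemma lmul_is_linear g : linear (lmul g).
Proof. by move=> c x y; rewrite /lmul mulrDr alg_quot_scalerAr. Qed.
HB.instance Definition _ g :=
  GRing.isLinear.Build K B B *:%R (lmul g) (lmul_is_linear g).

Lemma ord_monom_step (n : nat) (x : 'I_n -> B) j a h :
  (forall i k, i != k -> x i * x k = - (x k * x i)) ->
  x j * (ord_monom x a * h)
  = expo_sign K j a *: (ord_monom x (expo_incr j a) * h).
Proof.
move=> x_anti; rewrite !ord_monom_act; apply: monom_act_step.
  by move=> i c z; rewrite alg_quot_scalerAr.
by move=> i k z ik; rewrite mulrA x_anti // mulNr -mulrA.
Qed.

Lemma ord_monom0 (n : nat) (x : 'I_n -> B) : ord_monom x (expo0 n) = 1.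
Proof. by rewrite /ord_monom big1 // => i _; rewrite ffunE. Qed.

End QuotientAlgebra.

Lemma skew_poly_spanned (K : fieldType) (n : nat) (p : skew_poly K n) :
  spanned (ord_monom (pres_gen (@skew_rel K n))) p.
Proof.
set x := pres_gen _.
have x_anti i k : i != k -> x i * x k = - (x k * x i).
  move=> ik; have := alg_pi_rel (skew_anticomm K ik).
  rewrite raddfD /= !rmorphM raddf0 /= => /eqP.
  by rewrite addr_eq0 => /eqP.
rewrite -[p]alg_reprK; elim/free_alg_ind: (alg_repr p) => [c q r eq er||i q eq].
- by rewrite linearP; apply: in_spanD => //; apply: in_spanZ.
- by rewrite rmorph1 -(ord_monom0 x); apply: spanned_gen.
rewrite rmorphM; apply: (spanned_map (f := lmul (x i)) _ eq) => a.
rewrite /= /lmul -[ord_monom x a]mulr1 ord_monom_step // mulr1.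
exact/in_spanZ/spanned_gen.
Qed.

Section DahaSpanned.
Variables (K : fieldType) (X : weyl_type) (n : nat) (t u v : K).
Local Notation W := (weyl X n).
Local Notation H := (odd_daha X n t u v).
Local Notation Xi := (Xi X t u v).
Local Notation Eta := (Eta X t u v).
Local Notation Weyl := (@Weyl K X n t u v).
Local Notation S := (spanned (@pbw_monom K X n t u v)).
Implicit Types (i j : 'I_n) (w r : W) (h : H).

Lemma Xi_anti i j : i != j -> Xi i * Xi j = - (Xi j * Xi i).
Proof.
move=> /daha_xi H0; have := alg_pi_rel (H0 K X t u v).
by rewrite raddfN /= !rmorphM.
Qed.

Lemma Eta_anti i j : i != j -> Eta i * Eta j = - (Eta j * Eta i).
Proof.
move=> /daha_eta H0; have := alg_pi_rel (H0 K X t u v).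
by rewrite raddfN /= !rmorphM.
Qed.

Lemma WeylM w r : Weyl w * Weyl r = Weyl (r * w)%g.
Proof. by have := alg_pi_rel (daha_mul t u v w r); rewrite rmorphM. Qed.

Lemma Weyl1 : Weyl 1%g = 1.
Proof. by have := alg_pi_rel (daha_one X n t u v); rewrite rmorph1. Qed.

Lemma Weyl_Xi w j : Weyl w * Xi j = Xi (forget_signs w j) * Weyl w.
Proof. by have := alg_pi_rel (daha_weyl_xi t u v w j); rewrite !rmorphM. Qed.

Lemma Weyl_Eta w j : Weyl w * Eta j = Eta (forget_signs w j) * Weyl w.
Proof. by have := alg_pi_rel (daha_weyl_eta t u v w j); rewrite !rmorphM. Qed.

Lemma Eta_Xi i j h : Eta i * (Xi j * h)
  = bracket t u v (fun w => lmul (Weyl w)) i j h - Xi j * (Eta i * h).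
Proof.
have E : Eta i * Xi j + Xi j * Eta i = daha_pi t u v (daha_rhs X t u v i j).
  rewrite /Eta /Xi /daha_pi -!rmorphM -raddfD /daha_rhs.
  case: eqVneq => [<-|ij]; apply: alg_pi_rel; first exact: daha_eta_xi_eq.
  exact: daha_eta_xi_neq.
pose ev (p : free_alg K (daha_gen X n)) : H := daha_pi t u v p * h.
have ev_lin : linear ev.
  by move=> c p q; rewrite /ev /daha_pi linearP mulrDl alg_quot_scalerAl.
pose L := GRing.isLinear.Build K _ H *:%R ev ev_lin.
pose evL : {linear _ -> H} := HB.pack_for {linear _ -> H} ev L.
rewrite -(daha_rhs_bracket t u v (ev := evL) (x := h)) //; last first.
  by rewrite /= /ev /daha_pi rmorph1 mul1r.
by rewrite /= /ev -E mulrDl !mulrA addrK.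
Qed.

Lemma spanned_Xi j h : S h -> S (Xi j * h).
Proof.
apply: (spanned_map (f := lmul (Xi j))) => -[[a w] b].
rewrite /= /lmul /pbw_monom /= -!mulrA ord_monom_step; last exact: Xi_anti.
rewrite mulrA; apply: in_spanZ.
exact: (spanned_gen _ (expo_incr j a, w, b)).
Qed.

Lemma spanned_vac w b : S (Weyl w * ord_monom Eta b).
Proof.
have := spanned_gen (@pbw_monom K X n t u v) (expo0 n, w, b).
by rewrite /pbw_monom ord_monom0 mul1r.
Qed.

(** Monomials are reached from those without [Xi] by multiplying on the left
    by the [Xi], so that a linear map need only be followed along such
    multiplications to see that it preserves the span. *)
Lemma spanned_Xi_ind (f : {linear H -> H}) :
  (forall w b, S (f (Weyl w * ord_monom Eta b))) ->
  (forall j h, S h -> S (f h) -> S (f (Xi j * h))) ->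
  forall h, S h -> S (f h).
Proof.
move=> f_vac f_Xi h; apply: spanned_map => -[[a w] b].
rewrite /pbw_monom -mulrA ord_monom_act /=.
set P := fun h => S h /\ S (f h).
suff [] : P (monom_act (fun i => *%R (Xi i)) a (Weyl w * ord_monom Eta b)).
  by [].
apply: monom_act_closed => [i z [Sz Sfz]|]; split; try exact: spanned_vac.
- exact: spanned_Xi.
- exact: f_Xi.
- exact: f_vac.
Qed.

Lemma spanned_Weyl w h : S h -> S (Weyl w * h).
Proof.
apply: (spanned_Xi_ind (f := lmul (Weyl w))) => [r b|j z _ Sz].
  by rewrite /= /lmul mulrA WeylM; apply: spanned_vac.
by rewrite /= /lmul mulrA Weyl_Xi -mulrA; apply: spanned_Xi.
Qed.

Lemma spanned_bracket i j h :
  S h -> S (bracket t u v (fun w => lmul (Weyl w)) i j h).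
Proof.
move=> Sh; have Sr k l : S (refl_op (fun w => lmul (Weyl w)) k l h).
  by apply: spanned_sum => r _; apply: spanned_Weyl.
rewrite /bracket; case: eqP => _; last exact/in_spanZ/Sr.
apply: in_spanD; last by apply/in_spanZ/spanned_sum => r _; apply: spanned_Weyl.
by apply: in_spanD; apply: in_spanZ => //; apply: spanned_sum.
Qed.

Lemma spanned_Eta i h : S h -> S (Eta i * h).
Proof.
have S_vac k w b : S (Eta k * (Weyl w * ord_monom Eta b)).
  have -> : k = forget_signs w ((forget_signs w)^-1%g k) by rewrite permKV.
  rewrite mulrA -Weyl_Eta -mulrA -[ord_monom _ _]mulr1.
  rewrite ord_monom_step; last exact: Eta_anti.
  by rewrite mulr1 -alg_quot_scalerAr; apply/in_spanZ/spanned_vac.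
apply: (spanned_Xi_ind (f := lmul (Eta i))) => [w b|j z Sz Sez].
  exact: S_vac.
rewrite /= /lmul Eta_Xi; apply: in_spanD; first exact: spanned_bracket.
exact/spannedN/spanned_Xi.
Qed.

Lemma daha_spanned h : S h.
Proof.
rewrite -[h]alg_reprK; elim/free_alg_ind: (alg_repr h) => [c p q Sp Sq||g p Sp].
- by rewrite linearP; apply: in_spanD => //; apply: in_spanZ.
- have := spanned_vac 1%g (expo0 n).
  by rewrite Weyl1 ord_monom0 mulr1 rmorph1.
rewrite rmorphM; case: g => [[i|i]|w].
- exact: spanned_Xi.
- exact: spanned_Eta.
- exact: spanned_Weyl.
Qed.

End DahaSpanned.
(** * Tensor products *)

Section QuotientMap.
Variables (K : fieldType) (V U : lmodType K) (S : submodClosed V).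

Lemma lquot_rec (f : {linear V -> U}) : (forall x, x \in S -> f x = 0) ->
  exists g : {linear lquot S -> U}, forall x, g (lquot_pi S x) = f x.
Proof.
move=> fS; pose g (q : lquot S) := f (lquot_repr q).
have gE x : g (lquot_pi S x) = f x.
  by apply/eqP; rewrite -subr_eq0 /g -raddfB /= fS ?lquot_reprP.
have g_lin : linear g.
  move=> c p q; rewrite -[p]lquot_reprK -[q]lquot_reprK -linearP !gE.
  exact: linearP.
pose L := GRing.isLinear.Build K (lquot S) U *:%R g g_lin.
by exists (HB.pack_for {linear lquot S -> U} g L).
Qed.

End QuotientMap.

Section TensorTheory.
Variables (K : fieldType) (U V : lmodType K).

Lemma bilin_rel_eq (x y : {malg K[(U * V)%type]}) :
  bilin_rel (x - y) ->
  lquot_pi (Defs.span (@bilin_rel K U V)) x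
  = lquot_pi (Defs.span (@bilin_rel K U V)) y.
Proof. by move=> r; apply/lquot_eqP/asboolP/in_span_gen. Qed.

Lemma tensDl (x x' : U) (y : V) : tens (x + x') y = tens x y + tens x' y.
Proof. by rewrite /tens -raddfD; apply/bilin_rel_eq/bilin_addl. Qed.

Lemma tensDr (x : U) (y y' : V) : tens x (y + y') = tens x y + tens x y'.
Proof. by rewrite /tens -raddfD; apply/bilin_rel_eq/bilin_addr. Qed.

Lemma tensZl c (x : U) (y : V) : tens (c *: x) y = c *: tens x y.
Proof. by rewrite /tens -linearZ; apply/bilin_rel_eq/bilin_scalel. Qed.

Lemma tensZr c (x : U) (y : V) : tens x (c *: y) = c *: tens x y.
Proof. by rewrite /tens -linearZ; apply/bilin_rel_eq/bilin_scaler. Qed.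

Lemma tens0l (y : V) : tens (0 : U) y = 0.
Proof. by rewrite -[X in tens X _](scale0r 0) tensZl scale0r. Qed.

Lemma tens0r (x : U) : tens x (0 : V) = 0.
Proof. by rewrite -[X in tens _ X](scale0r 0) tensZr scale0r. Qed.

Lemma tensor_rec (Z : lmodType K) (f : U -> V -> Z) :
  (forall y, linear (f^~ y)) -> (forall x, linear (f x)) ->
  exists g : {linear tensor U V -> Z}, forall x y, g (tens x y) = f x y.
Proof.
move=> fl fr.
have [F FE] : exists F : {linear {malg K[(U * V)%type]} -> Z},
    forall x y, F << (x, y) >> = f x y.
  exists (lin_ext (fun p : (U * V)%type => f p.1 p.2)) => x y.
  exact: lin_ext_basis.
have [|g gE] := @lquot_rec K _ Z (Defs.span (@bilin_rel K U V)) F; last first.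
  by exists g => x y; rewrite -FE; apply: gE.
move=> z /asboolP; elim=> {z} [_ []||z w _ ez _ ew|c z _ ez].
- move=> x x' y; rewrite raddfB raddfD /= !FE.
  by rewrite -[x]scale1r fl !scale1r subrr.
- move=> x y y'; rewrite raddfB raddfD /= !FE.
  by rewrite -[y]scale1r fr !scale1r subrr.
- move=> c x y; rewrite raddfB /= linearZ /= !FE.
  have f0 : f 0 y = 0.
    by have := fl y (-1) 0 0; rewrite scaleN1r addNr scaleN1r addNr.
  by rewrite -[c *: x]addr0 fl f0 addr0 subrr.
- move=> c x y; rewrite raddfB /= linearZ /= !FE.
  have f0 : f x 0 = 0.
    by have := fr x (-1) 0 0; rewrite scaleN1r addNr scaleN1r addNr.
  by rewrite -[c *: y]addr0 fr f0 addr0 subrr.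
- exact: raddf0.
- by rewrite raddfD /= ez ew addr0.
- by rewrite linearZ /= ez scaler0.
Qed.

Lemma spanned_tens (T T' : Type) (e : T -> U) (e' : T' -> V) (q : tensor U V) :
  (forall x, spanned e x) -> (forall y, spanned e' y) ->
  spanned (fun k : (T * T')%type => tens (e k.1) (e' k.2)) q.
Proof.
move=> eU e'V; rewrite -[q]lquot_reprK.
elim/malg_ind: (lquot_repr q) => [|c x y ex ey|[x y]].
- by rewrite raddf0; apply: in_span0.
- by rewrite linearP; apply: in_spanD => //; apply: in_spanZ.
rewrite -/(tens x y).
elim: (eU x) => {x} [_ [k ->]||x x' _ sx _ sx'|c x _ sx].
- elim: (e'V y) => {y} [_ [l ->]||y y' _ sy _ sy'|c y _ sy].
  + exact: (spanned_gen _ (k, l)).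
  + by rewrite tens0r; apply: in_span0.
  + by rewrite tensDr; apply: in_spanD.
  + by rewrite tensZr; apply: in_spanZ.
- by rewrite tens0l; apply: in_span0.
- by rewrite tensDl; apply: in_spanD.
- by rewrite tensZl; apply: in_spanZ.
Qed.

End TensorTheory.

Lemma group_space_spanned (K : fieldType) (gT : finGroupType)
    (x : group_space K gT) :
  spanned (fun g : gT => << g >> : group_space K gT) x.
Proof.
elim/malg_ind: x => [|c x y ex ey|g]; first exact: in_span0.
- by apply: in_spanD => //; apply: in_spanZ.
- exact: spanned_gen.
Qed.

(** * The basis theorem *)

Lemma pbw_monom_basis (K : fieldType) (X : weyl_type) (n : nat) (t u v : K) :
  is_basis (@pbw_monom K X n t u v).
Proof.
split; first exact: pbw_monom_free.
by move=> h; apply/spanned_lin_ext/daha_spanned.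
Qed.

Section Multiplication.
Variables (K : fieldType) (X : weyl_type) (n : nat) (t u v : K).
Local Notation W := (weyl X n).
Local Notation H := (odd_daha X n t u v).
Local Notation C := (skew_poly K n).
Local Notation G := (group_space K W).

Lemma daha_mult_exists :
  exists phi : {linear tensor (tensor C G) C -> H}, forall p w q,
    phi (tens (tens p w) q)
    = skew_xi X t u v p * weyl_map t u v w * skew_eta X t u v q.
Proof.
have [p1|p1|phi1 phi1E] := @tensor_rec K C G H
  (fun p w => skew_xi X t u v p * weyl_map t u v w).
- by move=> c x y; rewrite linearP mulrDl alg_quot_scalerAl.
- by move=> c x y; rewrite linearP mulrDr alg_quot_scalerAr.
have [q|z|phi phiE] := @tensor_rec K (tensor C G) C H
  (fun z q => phi1 z * skew_eta X t u v q).
- by move=> c x y; rewrite linearP mulrDl alg_quot_scalerAl.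
- by move=> c x y; rewrite linearP mulrDr alg_quot_scalerAr.
by exists phi => p w q; rewrite phiE phi1E.
Qed.

Lemma skew_xi_monom a :
  skew_xi X t u v (ord_monom (pres_gen (@skew_rel K n)) a)
  = ord_monom (Xi X t u v) a.
Proof.
rewrite /ord_monom rmorph_prod; apply: eq_bigr => i _.
by rewrite rmorphXn; congr (_ ^+ _); apply: skew_xi_gen.
Qed.

Lemma skew_eta_monom b :
  skew_eta X t u v (ord_monom (pres_gen (@skew_rel K n)) b)
  = ord_monom (Eta X t u v) b.
Proof.
rewrite /ord_monom rmorph_prod; apply: eq_bigr => i _.
by rewrite rmorphXn; congr (_ ^+ _); apply: skew_eta_gen.
Qed.

(** A linear map that carries a spanning family to a basis is bijective; here
    the spanning family is made of the tensors of monomials. *)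
Lemma daha_mult_bijective (phi : {linear tensor (tensor C G) C -> H}) :
  (forall p w q, phi (tens (tens p w) q)
     = skew_xi X t u v p * weyl_map t u v w * skew_eta X t u v q) ->
  bijective phi.
Proof.
move=> phiE; pose x := pres_gen (@skew_rel K n).
pose e (k : {ffun 'I_n -> nat} * W * {ffun 'I_n -> nat}) :=
  tens (tens (ord_monom x k.1.1) (<< k.1.2 >> : G)) (ord_monom x k.2)
    : tensor (tensor C G) C.
have e_span z : spanned e z.
  apply: (spanned_tens (e := fun k : {ffun 'I_n -> nat} * W =>
    tens (ord_monom x k.1) (<< k.2 >> : G))); last exact: skew_poly_spanned.
  move=> y; apply: (spanned_tens (e' := fun w : W => << w >> : G)).
    exact: skew_poly_spanned.
  exact: group_space_spanned.
have phi_e k : phi (e k) = pbw_monom t u v k.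
  rewrite phiE skew_xi_monom skew_eta_monom; congr (_ * _ * _).
  exact: lin_ext_basis.
have phi_lin c : phi (lin_ext e c) = lin_ext (@pbw_monom K X n t u v) c.
  rewrite /lin_ext raddf_sum; apply: eq_bigr => k _.
  by rewrite -phi_e; apply: linearZ_LR.
have [free gen] := pbw_monom_basis X n t u v.
have inj : injective phi.
  apply: raddf_inj => z; have [c ->] := spanned_lin_ext (e_span z).
  move=> z0; suff -> : c = 0 by rewrite raddf0.
  by apply: free; rewrite -phi_lin.
have surj h : exists z, phi z = h.
  by have [c ->] := gen h; exists (lin_ext e c).
exists (fun h => projT1 (cid (surj h))) => [z|h].
  by apply: inj; apply: projT2 (cid (surj (phi z))).
exact: projT2 (cid (surj h)).
Qed.

End Multiplication.

Theorem theorem5p7 (R : realType) (X : weyl_type) (n : nat) (t u v : R[i]) :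
  (exists phi : {linear
       tensor (tensor (skew_poly R[i] n) (group_space R[i] (weyl X n)))
              (skew_poly R[i] n)
       -> odd_daha X n t u v},
     (forall (p : skew_poly R[i] n) (w : group_space R[i] (weyl X n))
             (q : skew_poly R[i] n),
        phi (tens (tens p w) q)
        = skew_xi X t u v p * weyl_map t u v w * skew_eta X t u v q)
     /\ bijective phi)
  /\ is_basis
       (fun abs : {ffun 'I_n -> nat} * weyl X n * {ffun 'I_n -> nat} =>
          ord_monom (Xi X t u v) abs.1.1 * Weyl t u v abs.1.2
          * ord_monom (Eta X t u v) abs.2).
Proof.
split; last exact: pbw_monom_basis.
have [phi phiE] := daha_mult_exists X n t u v.
by exists phi; split=> //; apply: daha_mult_bijective.
Qed.
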